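(* There exists a compact HNUP set $E\subset\mathbb{C}$ such that $\dim_H E=2$, $m_2(E)=0$ and $\operatorname{Cap}E>0$. Hence, for any $0<s<2$ and any $0<c<\infty$, there exists a compact HNUP subset $K$ of $E$ such that $\dim_H K=s$ and $H^s(K)=c$. Moreover, the set $E$ can be arranged so that it also satisfies the following additional property: for each $x\in E$ and each $M>1$ there exist two positive numbers $r,R$ with $R/r\ge M$ such that $\{y\in\mathbb{C}: r<|y-x|<R\}\subset\mathbb{C}\setminus E$ and $\{y\in\mathbb{C}: |y-x|\ge R\}\cap E\neq\emptyset$.
   Context: $m_2$ is Lebesgue 2-dimensional measure on $\mathbb{C}\cong\mathbb{R}^2$. $H^s$ is $s$-dimensional Hausdorff measure, $H^s(E)=\lim_{\epsilon\to0^+}\inf\{\sum_k d(B_k)^s\}$, the infimum being over countable covers of $E$ by sets $B_k$ with Euclidean diameters $d(B_k)<\epsilon$; $\dim_H$ is Hausdorff dimension. Logarithmic capacity: for a compact set $E\subset\mathbb{C}$ and $n\ge 2$, let $P_n=\max\prod_{1\le j<k\le n}|z_j-z_k|$ over $z_1,\dots,z_n\in E$, and $D_n=P_n^{2/(n(n-1))}$. The sequence $D_n$ is non-increasing, and $\operatorname{Cap}E=\lim_{n\to\infty}D_n$. Uniformly perfect: for $w\in\mathbb{C}$ and $0<r<R<\infty$ let $\mathrm{Ann}(w;r,R)=\{z\in\mathbb{C}: r<|z-w|<R\}$, with modulus $\log(R/r)$. The annulus $A$ separates a set $F\subset\mathbb{C}$ if $F\cap A=\emptyset$ and $F$ intersects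 both components of $\mathbb{C}\setminus A$. A compact set $F\subset\mathbb{C}$ with two or more points is uniformly perfect if there is a uniform finite upper bound on the moduli of all annuli which separate $F$. HNUP (hereditarily non uniformly perfect): a compact set $E$ is HNUP if no (compact) subset of $E$ is uniformly perfect. *)

(* Defs.v *)
From HB Require Import structures.
From mathcomp Require Import all_boot all_order all_algebra.
From mathcomp Require Import all_classical all_reals all_analysis.

Set Implicit Arguments.
Unset Strict Implicit.
Unset Printing Implicit Defensive.

Import Order.TTheory GRing.Theory Num.Theory.
Import numFieldNormedType.Exports.

Local Open Scope classical_set_scope.
Local Open Scope ring_scope.

(* The complex plane is identified with R * R, whose product topology and
   product Lebesgue measure are the Euclidean ones.  The library norm on R * R
   is the maximum norm, so the modulus |z - w| is defined separately. *)
Definition cdist (R : realType) (z w : R * R) : R :=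
  Num.sqrt ((z.1 - w.1) ^+ 2 + (z.2 - w.2) ^+ 2).

Definition m2 (R : realType) (E : set (R * R)) : \bar R :=
  ((@lebesgue_measure R) \x (@lebesgue_measure R))%E E.

(* Euclidean diameter; +oo for unbounded sets, and 0 (not -oo) for set0. *)
Definition ediam (R : realType) (B : set (R * R)) : \bar R :=
  maxe 0%E (ereal_sup [set t | exists z w, [/\ B z, B w & t = (cdist z w)%:E]]).

(* The index set D lets the countable cover be finite as well as infinite;
   this matters only for s = 0, where 0 `^ 0 = 1. *)
Definition is_fine_cover (R : realType) (eps : R) (E : set (R * R))
    (D : set nat) (B : nat -> set (R * R)) : Prop :=
  E `<=` \bigcup_(k in D) B k /\
  forall k, D k -> (ediam (B k) < eps%:E)%E.

Definition hausdorff_content (R : realType) (s eps : R) (E : set (R * R)) :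
    \bar R :=
  ereal_inf [set t | exists D B, is_fine_cover eps E D B /\
                       t = (\esum_(k in D) (ediam (B k) `^ s))%E].

(* Intended for s >= 0. *)
Definition hausdorff_measure (R : realType) (s : R) (E : set (R * R)) :
    \bar R :=
  lim (hausdorff_content s eps E @[eps --> 0^'+]).

Definition hausdorff_dim (R : realType) (E : set (R * R)) : \bar R :=
  ereal_inf [set s%:E | s in
    [set s : R | 0 <= s /\ hausdorff_measure s E = 0%E]].

(* P_n; the supremum is a maximum when E is compact and nonempty. *)
Definition cap_prod (R : realType) (E : set (R * R)) (n : nat) : R :=
  sup [set \prod_(j < n) \prod_(k < n | (j < k)%N) cdist (z j) (z k)
      | z in [set z : 'I_n -> R * R | forall i, E (z i)]].

(* D_n = P_n ^ (2 / (n (n - 1))), meaningful for n >= 2. *)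
Definition transfinite_diam (R : realType) (E : set (R * R)) (n : nat) : R :=
  cap_prod E n `^ (2%:R / (n * n.-1)%:R).

Definition log_capacity (R : realType) (E : set (R * R)) : R :=
  lim (transfinite_diam E n @[n --> \oo]).

Definition annulus (R : realType) (w : R * R) (r1 r2 : R) : set (R * R) :=
  [set z | r1 < cdist z w /\ cdist z w < r2].

(* F meets both components of the complement of the annulus: F meets the
   connected component of every point of that complement. *)
Definition separates (R : realType) (w : R * R) (r1 r2 : R)
    (F : set (R * R)) : Prop :=
  F `&` annulus w r1 r2 = set0 /\
  forall z, ~ annulus w r1 r2 z ->
    F `&` connected_component (~` annulus w r1 r2) z !=set0.

Definition uniformly_perfect (R : realType) (F : set (R * R)) : Prop :=
  [/\ compact F,
      exists a b, [/\ F a, F b & a <> b] &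
      exists C : R, forall (w : R * R) (r1 r2 : R),
        0 < r1 -> r1 < r2 -> separates w r1 r2 F -> ln (r2 / r1) <= C].

Definition HNUP (R : realType) (E : set (R * R)) : Prop :=
  compact E /\ forall F, F `<=` E -> ~ uniformly_perfect F.

(* Main.v *)
(* E is A x A, where A consists of the numbers in [0, 1] whose binary digits
   vanish on the blocks of places [8^k, 8^k + k).  The k-th block isolates the
   dyadic cells of level 8^k by annuli of modulus comparable to k, which gives
   both the annulus property and the absence of uniformly perfect subsets.
   The blocks have density zero but unbounded total length, so E has dimension
   2 and measure 0.  Reading the free digits of a point of A as consecutive
   binary digits gives a Hoelder "staircase" from A onto [0, 1]; preimages of
   equally spaced points bound the capacity from below.
   For 0 < s < 2, freezing further digits so that the number of free ones among
   the first n stays above s n / 2 + C, and within a bounded distance of it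
   infinitely often, gives A' such that H^s (A' x A') is finite and, by mapping
   A' x A' onto the unit square with two staircases, as large as desired.
   Cutting A' x A' at height t of the first staircase changes H^s in a
   Lipschitz way, so every value c is attained. *)

Require Import Defs.
From HB Require Import structures.
From mathcomp Require Import all_boot all_order all_algebra.
From mathcomp Require Import all_classical all_reals all_analysis.
From mathcomp Require Import measurable_realfun ring lra zify.

Import Order.TTheory GRing.Theory Num.Theory.
Import numFieldNormedType.Exports.

Local Open Scope classical_set_scope.
Local Open Scope ring_scope.

Implicit Types J b : nat -> bool.

(** * Binary digits and the staircase *)

Definition hpow (R : realType) (n : nat) : R := 2^-1 ^+ n.

(* [J] is the set of free binary places; places are numbered from 0, so that
   the digit at place [i] has weight [hpow R i.+1]. *)
Definition rank (J : nat -> bool) (n : nat) : nat := (\sum_(i < n) J i)%N.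

(** The weight of place [i] when the free digits are read consecutively, and 0 off [J]; written as a
    difference so that sums telescope. *)
Definition wgt (R : realType) (J : nat -> bool) (i : nat) : R :=
  hpow R (rank J i) - hpow R (rank J i.+1).

Definition psum (R : realType) (J b : nat -> bool) (n : nat) : R :=
  \sum_(i < n) wgt R J i *+ b i.

(* The number whose consecutive binary digits are the digits of [b] at the
   places of [J]. *)
Definition stair (R : realType) (J b : nat -> bool) : R :=
  sup (range (psum R J b)).

Definition restr (J b : nat -> bool) (i : nat) : bool := J i && b i.

(** [stair] with every place free is the ordinary binary expansion; digits off [J] are set to 0. *)
Definition pt (R : realType) (J b : nat -> bool) : R :=
  stair R xpredT (restr J b).

Lemma hpow_gt0 (R : realType) n : 0 < hpow R n.
Proof. by rewrite exprn_gt0// invr_gt0. Qed.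

Lemma hpowS (R : realType) n : hpow R n = hpow R n.+1 *+ 2.
Proof. by rewrite /hpow exprS -mulrnAl -[2^-1 *+ 2]mulr_natr mulVf// mul1r. Qed.

Lemma hpow_le (R : realType) m n : (m <= n)%N -> hpow R n <= hpow R m.
Proof.
by move=> mn; rewrite ler_wiXn2l// ?invr_ge0// invf_le1// ler1n.
Qed.

Lemma hpow_le1 (R : realType) n : hpow R n <= 1.
Proof. exact: (hpow_le R 0 n). Qed.

Lemma hpow_natV (R : realType) n : hpow R n * (2 ^ n)%:R = 1.
Proof. by rewrite /hpow natrX -exprMn mulVf// expr1n. Qed.

Lemma hpow_lt (R : realType) (e : R) : 0 < e -> exists n, hpow R n < e.
Proof.
move=> e0; exists (Num.truncn e^-1).+1.
rewrite /hpow exprVn -[ltRHS]invrK ltf_pV2 ?posrE ?invr_gt0 ?exprn_gt0//.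
apply: lt_trans (truncnS_gt _) _.
by rewrite -natrX ltr_nat ltn_expl.
Qed.

Lemma hpow_powR (R : realType) n : hpow R n = 2 `^ (- n%:R).
Proof. by rewrite powRN powR_mulrn// /hpow exprVn. Qed.

Lemma rankS J n : rank J n.+1 = (rank J n + J n)%N.
Proof. by rewrite /rank big_ord_recr. Qed.

Lemma rank_predT n : rank xpredT n = n.
Proof. by rewrite /rank sum1_card card_ord. Qed.

Lemma rank_sub J n : (rank J n <= n)%N.
Proof.
elim: n => [|n IH]; first by rewrite /rank big_ord0.
by rewrite rankS -addn1 leq_add// leq_b1.
Qed.

Lemma wgtE (R : realType) J i : wgt R J i = hpow R (rank J i.+1) *+ J i.
Proof.
rewrite /wgt rankS; case: (J i); last by rewrite addn0 subrr mulr0n.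
by rewrite addn1 (hpowS _ (rank J i)) mulr2n mulr1n addrK.
Qed.

Lemma wgt_ge0 (R : realType) J i : 0 <= wgt R J i.
Proof. by rewrite wgtE mulrn_wge0// ltW// hpow_gt0. Qed.

Lemma wgt_predT (R : realType) i : wgt R xpredT i = hpow R i.+1.
Proof. by rewrite wgtE rank_predT. Qed.

Lemma psumS (R : realType) J b n :
  psum R J b n.+1 = psum R J b n + wgt R J n *+ b n.
Proof. by rewrite /psum big_ord_recr. Qed.

Lemma psum0 (R : realType) J b : psum R J b 0 = 0.
Proof. by rewrite /psum big_ord0. Qed.

Lemma eq_psum (R : realType) J b b' n :
  (forall i, (i < n)%N -> J i -> b i = b' i) -> psum R J b n = psum R J b' n.
Proof.
move=> bb'; apply: eq_bigr => -[i /= ilt] _; rewrite wgtE.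
by case: (boolP (J i)) => [Ji|]; rewrite ?mul0rn// bb'.
Qed.

(** The weights from [n] to [N] telescope to the difference of powers, reached when all these digits
    are 1. *)
Lemma psum_itv (R : realType) J b n N : (n <= N)%N ->
  psum R J b n <= psum R J b N <=
    psum R J b n + (hpow R (rank J n) - hpow R (rank J N)).
Proof.
move=> /subnKC <-; elim: (N - n)%N => [|k IH].
  by rewrite addn0 subrr addr0 lexx.
rewrite addnS psumS; have := wgt_ge0 R J (n + k); move: IH.
by rewrite /wgt; case: (b (n + k)%N) => /= ? ?; rewrite ?mulr1n ?mulr0n; lra.
Qed.

Lemma psum_ubound (R : realType) J b n :
  ubound (range (psum R J b)) (psum R J b n + hpow R (rank J n)).
Proof.
move=> _ [N _ <-]; have := hpow_gt0 R (rank J n).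
case: (leqP n N) => [/(psum_itv R J b)|/ltnW/(psum_itv R J b)];
  have := hpow_gt0 R (rank J N); lra.
Qed.

Lemma psum_le_stair (R : realType) J b n : psum R J b n <= stair R J b.
Proof.
by apply: ub_le_sup; [exists (psum R J b n + hpow R (rank J n)); exact: psum_ubound|exists n].
Qed.

Lemma stair_le_psum (R : realType) J b n :
  stair R J b <= psum R J b n + hpow R (rank J n).
Proof.
by apply: ge_sup; [exists (psum R J b 0), 0%N|exact: psum_ubound].
Qed.

Lemma stair_itv (R : realType) J b : 0 <= stair R J b <= 1.
Proof.
have := psum_le_stair R J b 0; have := stair_le_psum R J b 0.
by rewrite psum0 /rank big_ord0 /hpow expr0; lra.
Qed.

Lemma stair_close (R : realType) J b b' n :
  (forall i, (i < n)%N -> J i -> b i = b' i) ->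
  `|stair R J b - stair R J b'| <= hpow R (rank J n).
Proof.
move=> /(eq_psum R) e.
have := psum_le_stair R J b n; have := stair_le_psum R J b n.
have := psum_le_stair R J b' n; have := stair_le_psum R J b' n.
by rewrite ler_norml e; lra.
Qed.

Lemma pt_close (R : realType) J b b' n :
  (forall i, (i < n)%N -> J i -> b i = b' i) ->
  `|pt R J b - pt R J b'| <= hpow R n.
Proof.
move=> bb'; rewrite -[n]rank_predT; apply: stair_close => i ilt _.
by rewrite /restr; case: (boolP (J i)) => // /bb' ->.
Qed.

Lemma first_diff (b b' : nat -> bool) n :
  (forall i, (i < n)%N -> b i = b' i) \/
  exists i, [/\ (i < n)%N, forall l, (l < i)%N -> b l = b' l & b i <> b' i].
Proof.
elim: n => [|n [IH|[i [ilt ag di]]]]; first by left.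
- case: (b n =P b' n) => [e|ne]; [left|right; exists n; split => //].
  by move=> i; rewrite ltnS leq_eqVlt => /predU1P[->|/IH].
- by right; exists i; split=> //; apply: ltnW.
Qed.

(* The jump at the first difference exceeds the total weight after it exactly
   by the weight beyond [n]. *)
Lemma psum_diff (R : realType) J b b' i n : (i < n)%N ->
  (forall l, (l < i)%N -> b l = b' l) -> J i -> b i = false -> b' i = true ->
  psum R J b' n - psum R J b n =
    hpow R (rank J n) + \sum_(i.+1 <= l < n) wgt R J l *+ (b' l + ~~ b l).
Proof.
move=> ilt ag Ji bi b'i; rewrite -(subnKC ilt).
elim: (n - i.+1)%N => [|k IH].
  rewrite addn0 big_geq// !psumS (@eq_psum R J b b' i); last by move=> l /ag.
  by rewrite wgtE Ji bi b'i mulr0n !mulr1n; lra.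
rewrite addnS big_nat_recr ?leq_addr//= addrA; move: (i.+1 + k)%N IH => m IH.
have -> : hpow R (rank J m.+1) = hpow R (rank J m) - wgt R J m by rewrite /wgt; lra.
rewrite !psumS; move: IH; case: (b m); case: (b' m);
  rewrite /= ?addn0 ?addn1 ?mulr0n ?mulr1n ?mulr2n; lra.
Qed.

(** The tail of [b] beyond [n] weighs at most [hpow R (rank J n)] and is absorbed by the term of
    that size in [psum_diff]. *)
Lemma stair_diff_ge (R : realType) J b b' i n : (i < n)%N ->
  (forall l, (l < i)%N -> b l = b' l) -> J i -> b i = false -> b' i = true ->
  \sum_(i.+1 <= l < n) wgt R J l *+ (b' l + ~~ b l) <= stair R J b' - stair R J b.
Proof.
move=> ilt ag Ji bi b'i; have := psum_diff R J b b' i n ilt ag Ji bi b'i.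
have := stair_le_psum R J b n; have := psum_le_stair R J b' n; lra.
Qed.

(** One power comes from [psum_diff], the other bounds the tail of [b']. *)
Lemma stair_diff_le (R : realType) J b b' i n : (i < n)%N ->
  (forall l, (l < i)%N -> b l = b' l) -> J i -> b i = false -> b' i = true ->
  stair R J b' - stair R J b <=
    hpow R (rank J n) *+ 2 + \sum_(i.+1 <= l < n) wgt R J l *+ (b' l + ~~ b l).
Proof.
move=> ilt ag Ji bi b'i; have := psum_diff R J b b' i n ilt ag Ji bi b'i.
have := stair_le_psum R J b' n; have := psum_le_stair R J b n; rewrite mulr2n; lra.
Qed.

Lemma sum_wgt_diff_ge0 (R : realType) J (b b' : nat -> bool) m n :
  0 <= \sum_(m <= l < n) wgt R J l *+ (b' l + ~~ b l).
Proof. by apply: sumr_ge0 => l _; rewrite mulrn_wge0// wgt_ge0. Qed.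

(* If the first difference is at [i], closeness of the points forces digits 0
   against 1 after [i], which also makes the staircase values close. *)
Lemma pt_stair (R : realType) J b b' n :
  `|pt R J b - pt R J b'| < hpow R n ->
  `|stair R J b - stair R J b'| <= hpow R (rank J n) *+ 2.
Proof.
have h0 := hpow_gt0 R (rank J n).
case: (first_diff (restr J b) (restr J b') n) => [ag _|].
  suff : `|stair R J b - stair R J b'| <= hpow R (rank J n) by rewrite mulr2n; lra.
  by apply: stair_close => l llt Jl; have := ag _ llt; rewrite /restr Jl.
case=> i [ilt ag di].
wlog : b b' ag di / restr J b i = false /\ restr J b' i = true.
  move=> hw; case: (boolP (restr J b i)) => [bi|bi].
    rewrite distrC [X in _ -> X <= _]distrC; apply: hw.
    - by move=> l /ag.
    - by move/esym.
    - by split=> //; apply/negP => b'i; apply: di; rewrite bi b'i.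
  by apply: hw => //; split; [exact: negbTE|move: di; rewrite (negbTE bi); case: restr].
move=> [bi b'i]; rewrite distrC => lt_n.
have ge := stair_diff_ge R xpredT (restr J b) (restr J b') i n ilt ag isT bi b'i.
have Ji : J i by move: b'i; rewrite /restr => /andP[].
have [bi' b'i'] : b i = false /\ b' i = true by move: bi b'i; rewrite /restr Ji.
(* A digit 1 of [b'] or 0 of [b] at [l] would separate the points by at least [hpow R l.+1], hence
   by [hpow R n]. *)
have zero l : (i < l < n)%N -> restr J b' l = false /\ restr J b l = true.
  move=> /andP[il ln].
  suff : (restr J b' l + ~~ restr J b l = 0)%N by do 2!case: restr.
  apply/eqP; rewrite -leqn0 leqNgt; apply/negP => pos.
  suff : hpow R n <= pt R J b' - pt R J b by move: lt_n; rewrite ltr_norml; lra.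
  apply: le_trans ge; rewrite (@big_cat_nat _ _ _ l)//=; last exact: ltnW.
  rewrite (big_ltn ln) wgt_predT.
  rewrite -[leLHS]add0r lerD ?sum_wgt_diff_ge0// -[leLHS]addr0 lerD ?sum_wgt_diff_ge0//.
  by rewrite (le_trans (hpow_le R _ _ ln))// -[leLHS]mulr1n ler_wpMn2l// ltW// hpow_gt0.
have ag' l : (l < i)%N -> restr J b l = restr J b' l by move/ag.
have eJ c l : psum R J (restr J c) l = psum R J c l.
  by apply: eq_psum => j _; rewrite /restr => ->.
have eS c : stair R J (restr J c) = stair R J c.
  by rewrite /stair; congr sup; apply/seteqP; split=> _ [l _ <-]; exists l.
have := stair_diff_le R J _ _ i n ilt ag' Ji bi b'i.
have := stair_diff_ge R J _ _ i n ilt ag' Ji bi b'i.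
rewrite !eS big_nat big1 => [|l]; last by move=> /zero[-> ->].
rewrite distrC ler_norml; lra.
Qed.

(* Zeros on a block of places cannot be compensated by later digits. *)
Lemma pt_gap (R : realType) J b b' a k :
  (forall l, (a <= l < a + k)%N -> J l = false) ->
  `|pt R J b - pt R J b'| <= hpow R (a + k) \/
  hpow R a - hpow R (a + k) <= `|pt R J b - pt R J b'|.
Proof.
move=> J0.
case: (first_diff (restr J b) (restr J b') a) => [ag|[i [ilt ag di]]]; [left|right].
  apply: pt_close => i ilt Ji; case: (ltnP i a) => ia.
    by have := ag _ ia; rewrite /restr Ji.
  by move: Ji; rewrite J0// ia.
wlog : b b' ag di / restr J b i = false /\ restr J b' i = true.
  move=> hw; case: (boolP (restr J b i)) => [bi|bi].
    rewrite distrC; apply: hw.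
    - by move=> l /ag.
    - by move/esym.
    - by split=> //; apply/negP => b'i; apply: di; rewrite bi b'i.
  by apply: hw => //; split; [exact: negbTE|move: di; rewrite (negbTE bi); case: restr].
move=> [bi b'i].
have ilt' : (i < a + k)%N by rewrite ltn_addr.
have ge := stair_diff_ge R xpredT (restr J b) (restr J b') i (a + k) ilt' ag isT bi b'i.
rewrite distrC; apply: le_trans (ler_norm _); apply: le_trans ge.
rewrite (@big_cat_nat _ _ _ a)//= ?leq_addr//.
rewrite -[leLHS]add0r lerD ?sum_wgt_diff_ge0//.
(* On the block both digits are 0, so each multiplicity is 1 and the weights telescope. *)
rewrite big_nat (eq_bigr (fun l => - hpow R l.+1 - - hpow R l)); last first.
  by move=> l /J0; rewrite /restr /wgt !rank_predT => ->; rewrite addn1 mulr1n opprK addrC.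
rewrite -big_nat (telescope_sumr (fun l => - hpow R l)) ?leq_addr//; last by lra.
Qed.

(** Greedy expansion of [u]: a digit is 1 whenever this keeps the partial sum at most [u]. *)
Fixpoint greedy (R : realType) (J : nat -> bool) (u : R) (n : nat) : R :=
  if n is m.+1 then greedy R J u m + wgt R J m *+ (greedy R J u m + wgt R J m <= u)%R
  else 0.

(** The greedy digits keep [u] between the partial sum and that sum plus [hpow R (rank J n)], which
    tends to 0 since the rank is unbounded. *)
Lemma stair_surj (R : realType) J (u : R) :
  (forall k, exists n, (k <= rank J n)%N) -> 0 <= u <= 1 ->
  exists b, stair R J b = u.
Proof.
move=> unb u01; pose b n := greedy R J u n + wgt R J n <= u.
exists b.
have e n : psum R J b n = greedy R J u n.
  by elim: n => [|n IH]; rewrite ?psum0// psumS IH.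
have itv n : psum R J b n <= u <= psum R J b n + hpow R (rank J n).
  elim: n => [|n IH]; first by rewrite psum0 /rank big_ord0 /hpow expr0 add0r.
  move: IH; rewrite psumS.
  have -> : b n = (psum R J b n + wgt R J n <= u) by rewrite e.
  have : wgt R J n = hpow R (rank J n) - hpow R (rank J n.+1) by [].
  have : wgt R J n <= hpow R (rank J n.+1).
    by rewrite wgtE; case: (J n); rewrite ?mulr1n ?mulr0n ?lexx// ltW// hpow_gt0.
  by case: (lerP (psum R J b n + wgt R J n) u) => /= ? ? ? ?; rewrite ?mulr1n ?mulr0n; lra.
have d n : `|stair R J b - u| <= hpow R (rank J n).
  have := itv n; have := psum_le_stair R J b n; have := stair_le_psum R J b n.
  by rewrite ler_norml; lra.
apply/eqP; rewrite -subr_eq0 -normr_le0 leNgt; apply/negP => /hpow_lt[k].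
have [n /(hpow_le R) kn] := unb k.
by apply/negP; rewrite -leNgt (le_trans (d n)).
Qed.

Lemma psum_nat (R : realType) J b n :
  exists k : nat, psum R J b n = k%:R * hpow R (rank J n).
Proof.
elim: n => [|n [k IH]]; first by exists 0%N; rewrite psum0 mul0r.
rewrite psumS IH wgtE rankS; case: (J n); last first.
  by exists k; rewrite addn0 mulr0n mul0rn addr0.
exists (k * 2 + b n)%N; rewrite addn1 (hpowS R (rank J n)) mulr1n natrD natrM.
by rewrite mulrDl -mulrA !mulr_natl.
Qed.

(** By [psum_diff], a first difference at a free place separates the partial sums by at least
    [hpow R (rank J n)]. *)
Lemma psum_inj (R : realType) J b b' n :
  psum R J b n = psum R J b' n -> forall i, (i < n)%N -> J i -> b i = b' i.
Proof.
have eJ c : psum R J (restr J c) n = psum R J c n.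
  by apply: eq_psum => j _; rewrite /restr => ->.
case: (first_diff (restr J b) (restr J b') n) => [ag _ i /ag + Ji|].
  by rewrite /restr Ji.
case=> i [ilt ag di].
wlog : b b' ag di / restr J b i = false /\ restr J b' i = true.
  move=> hw; case: (boolP (restr J b i)) => [bi|bi].
    move=> bb' l ll Jl; apply/esym; apply: (hw b' b) => //.
    - by move=> m /ag.
    - by move/esym.
    - by split=> //; apply/negP => b'i; apply: di; rewrite bi b'i.
  by apply: hw => //; split; [exact: negbTE|move: di; rewrite (negbTE bi); case: restr].
move=> [bi b'i] bb'.
have Ji : J i by move: b'i; rewrite /restr => /andP[].
have := psum_diff R J _ _ i n ilt ag Ji bi b'i.
rewrite !eJ bb' subrr => /esym/eqP; rewrite gt_eqF//.
by rewrite ltr_pwDl ?hpow_gt0 ?sum_wgt_diff_ge0.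
Qed.

(** A piece consists of the points with given free digits below [n]. Its partial sum is [k / M] with
    [M = 2 ^ rank J n], and it can meet the slab only if [M t - 1 <= k <= M t']; rounding accounts
    for the constant 3. *)
Lemma slab_cover (R : realType) J n (t t' : R) : 0 <= t -> t <= t' ->
  exists (N : nat) (S : nat -> set R),
    [/\ N%:R <= (2 ^ rank J n)%:R * (t' - t) + 3,
      (forall b, t <= stair R J b <= t' -> exists2 j, (j < N)%N & S j (pt R J b)) &
      forall j x y, S j x -> S j y -> `|x - y| <= hpow R n].
Proof.
move=> t0 tt'; pose M : R := (2 ^ rank J n)%:R; pose f := Num.truncn (M * t).
have M0 : 0 < M by rewrite ltr0n expn_gt0.
have hM : hpow R (rank J n) * M = 1 by exact: hpow_natV.
exists (Num.truncn (M * (t' - t) + 2)).+1.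
(* Numbering starts at [f.-1], since [k] may be one below the floor [f] of [M * t]. *)
exists (fun j => [set pt R J b | b in
  [set b | psum R J b n = (j + f.-1)%:R * hpow R (rank J n)]]); split.
- have /andP[+ _] : (Num.truncn (M * (t' - t) + 2))%:R <= M * (t' - t) + 2 <
      (Num.truncn (M * (t' - t) + 2)).+1%:R.
    by apply: truncn_itv; rewrite addr_ge0// mulr_ge0 ?subr_ge0 ?(ltW M0).
  by rewrite -natr1; lra.
- move=> b /andP[tb bt']; have [k ek] := psum_nat R J b n.
  have kE : k%:R = psum R J b n * M by rewrite ek -mulrA hM mulr1.
  have kM : k%:R <= M * t'.
    rewrite kE mulrC ler_pM2l//.
    by apply: le_trans bt'; apply: psum_le_stair.
  have kM' : M * t <= k.+1%:R.
    rewrite -natr1 kE -[X in _ + X]hM -mulrDl [leRHS]mulrC ler_pM2l//.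
    exact: le_trans tb (stair_le_psum R J b n).
  have fM : f%:R <= M * t by rewrite truncn_le mulr_ge0// ltW.
  have fk : (f.-1 <= k)%N.
    by have : (f <= k.+1)%N; [rewrite -(ler_nat R); lra|lia].
  exists (k - f.-1)%N.
    rewrite ltnS truncn_ge_nat ?addr_ge0 ?mulr_ge0 ?subr_ge0 ?(ltW M0)//.
    have : M * t < f.+1%:R by exact: truncnS_gt.
    have : f.+1%:R <= f.-1%:R + 2 :> R by rewrite -natrD ler_nat; lia.
    by rewrite natrB//; lra.
  by exists b => //=; rewrite subnK.
- move=> j _ _ [b eb <-] [b' eb' <-]; apply: pt_close.
  by apply: (psum_inj R); rewrite eb eb'.
Qed.

Lemma hpow_between (R : realType) (d : R) n0 : 0 < d -> d < hpow R n0 ->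
  exists2 n, (n0 <= n)%N & hpow R n.+1 <= d < hpow R n.
Proof.
move=> d0 dn0; have ex : exists n, hpow R n <= d.
  by have [n /ltW] := hpow_lt R d d0; exists n.
case: (ex_minnP ex) => -[|n] hn minn.
  by have := lt_le_trans dn0 (hpow_le1 R n0); rewrite ltNge hn.
exists n.
  rewrite leqNgt; apply/negP => /(hpow_le R)/(le_trans)/(_ hn).
  by rewrite leNgt dn0.
rewrite hn/= ltNge; apply/negP => /minn; lia.
Qed.

(** At the scale [hpow R n.+1 <= d < hpow R n], [pt_stair] yields the bound
    [2 * kappa * (2 * d) ^ s], and [2 ^ s <= 2]. *)
Lemma pt_holder (R : realType) J (s kappa : R) n0 : 0 < s -> s <= 1 ->
  0 <= kappa ->
  (forall n, (n0 <= n)%N -> hpow R (rank J n) <= kappa * hpow R n `^ s) ->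
  forall b b', `|pt R J b - pt R J b'| < hpow R n0 ->
  `|stair R J b - stair R J b'| <= 4 * kappa * `|pt R J b - pt R J b'| `^ s.
Proof.
move=> s0 s1 k0 hk b b' lt_n0; set d := `|pt R J b - pt R J b'|.
have key n e : (n0 <= n)%N -> d < hpow R n -> hpow R n <= e ->
    `|stair R J b - stair R J b'| <= 2 * kappa * e `^ s.
  move=> nn dn ne; apply: (le_trans (pt_stair R J b b' n dn)).
  rewrite -[hpow _ _ *+ 2]mulr_natl -mulrA ler_pM2l// (le_trans (hk _ nn))// ler_wpM2l//.
  by apply: ge0_ler_powR => //; rewrite ?nnegrE ?ltW ?hpow_gt0// (lt_le_trans _ ne) ?hpow_gt0.
have [d0|d0] := eqVneq d 0; last first.
  have {}d0 : 0 < d by rewrite lt_neqAle eq_sym d0 normr_ge0.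
  have [n nn /andP[nd dn]] := hpow_between R d n0 d0 lt_n0.
  have /(key n _ nn dn) : hpow R n <= 2 * d.
    by rewrite hpowS -[hpow _ _ *+ 2]mulr_natl ler_pM2l.
  move=> /le_trans; apply; rewrite (_ : 4 = 2 * 2 :> R); last by rewrite -natrM.
  rewrite -!mulrA ler_pM2l// mulrCA ler_wpM2l// powRM ?(ltW d0)//.
  rewrite ler_wpM2r ?powR_ge0//.
  by rewrite -[leRHS]powRr1// ler_powR// ler1n.
(* If [d = 0], the estimate holds at every fine scale, which excludes a nonzero difference [A]; the
   1 added to the denominator covers [kappa = 0]. *)
rewrite d0 powR0 ?gt_eqF// mulr0 leNgt; apply/negP => A0.
pose A := `|stair R J b - stair R J b'|.
have B0 : 0 < A / (2 * kappa + 1) by rewrite divr_gt0// ltr_wpDl// mulr_ge0.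
have [n hn] := hpow_lt R _ (powR_gt0 s^-1 B0).
have := key (maxn n n0) _ (leq_maxr _ _) _ (le_trans (hpow_le R _ _ (leq_maxl n n0)) (ltW hn)).
rewrite d0 hpow_gt0 => /(_ isT); rewrite -powRrM mulVf ?gt_eqF// powRr1 ?(ltW B0)//.
apply/negP; rewrite -ltNge mulrA ltr_pdivrMr; last by rewrite ltr_wpDl// mulr_ge0.
rewrite -/A mulrC ltr_pM2l// ltrDl//.
Qed.

(** * Compactness of the Cantor sets *)

Lemma cantor_continuous (R : realType) (f : cantor_space -> R) (r : nat -> nat) :
  (forall k, exists n, (k <= r n)%N) ->
  (forall n b b', (forall i, (i < n)%N -> b i = b' i) ->
     `|f b - f b'| <= hpow R (r n)) ->
  continuous f.
Proof.
move=> unb close b; apply/cvgrPdist_lt => e e0.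
have [k hk] := hpow_lt R e e0; have [n /(hpow_le R) kn] := unb k.
(* Agreement on the first [n] digits is a finite intersection of open conditions in the product
   topology. *)
have : nbhs b [set b' : cantor_space | forall i : 'I_n, b i = b' i].
  apply: (@filter_forall _ _ (fun (i : 'I_n) (b' : cantor_space) => b i = b' i)
    (nbhs (b : cantor_space)) (nbhs_filter _)) => i.
  have h : nbhs (proj (i : nat) (b : prod_topology (fun _ : nat => bool))) [set b i].
    by rewrite nbhs_principalE; apply/principal_filterP.
  have := @proj_continuous nat (fun=> bool) i b _ h.
  by apply: filterS => b' /= ->.
apply: filterS => b' bb'; apply: le_lt_trans hk; apply: le_trans kn.
by apply: close => i ilt; exact: (bb' (Ordinal ilt)).
Qed.

(* [cant R J 1] is the whole Cantor set, since [stair] is at most 1. *)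
Definition cant (R : realType) J (t : R) : set R :=
  [set pt R J b | b in [set b | stair R J b <= t]].

(** The admissible digit strings form a closed subset of the compact Cantor space, on which [pt] is
    continuous. *)
Lemma cant_compact (R : realType) J (t : R) :
  (forall k, exists n, (k <= rank J n)%N) -> compact (cant R J t).
Proof.
move=> unb.
have cpt : continuous (pt R J : cantor_space -> R).
  apply: (cantor_continuous R _ id) => [k|n b b' bb']; first by exists k.
  by apply: pt_close => i /bb'.
have cst : continuous (stair R J : cantor_space -> R).
  apply: (cantor_continuous R _ (rank J)) => // n b b' bb'.
  by apply: stair_close => i /bb'.
apply: (@continuous_compact cantor_space); first exact: continuous_subspaceT.
apply: (subclosed_compact _ cantor_space_compact) => //.
rewrite (_ : mkset _ = stair R J @^-1` [set x | x <= t])//.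
by apply: closed_comp => // b _; exact: cst.
Qed.

(** * Sets of free places *)

(** With [l = trunc_log 8 i], a positive place [i] is frozen exactly when it is one of the [l]
    places from [8 ^ l] on. Truncated subtraction leaves place 0 free. *)
Definition free (i : nat) : bool := (trunc_log 8 i <= i - 8 ^ trunc_log 8 i)%N.

Lemma free_block k i : (8 ^ k <= i < 8 ^ k + k)%N -> free i = false.
Proof.
move=> /andP[ki ik].
have k8 : (k < 8 ^ k)%N by rewrite ltn_expl.
have l : trunc_log 8 i = k.
  by apply: trunc_log_eq => //; rewrite ki expnS; lia.
by rewrite /free l; lia.
Qed.

Lemma rank_flat J a k : (forall i, (a <= i < a + k)%N -> J i = false) ->
  rank J (a + k) = rank J a.
Proof.
elim: k => [|k IH] J0; first by rewrite addn0.
rewrite addnS rankS J0 ?leq_addr ?addnS//= addn0 IH// => i /andP[ai ik].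
by rewrite J0// ai addnS ltnS ltnW.
Qed.

(** The [k] frozen places of the block make the defect [n - rank free n] at least [k]; that it is
    unbounded gives area zero and the vanishing of [H^2]. *)
Lemma rank_free_block k : (rank free (8 ^ k + k) <= 8 ^ k)%N.
Proof. by rewrite rank_flat ?rank_sub// => i; exact: free_block. Qed.

(** Each interval [[8 ^ j, 8 ^ j.+1)] has at most [j] frozen places, so there are at most [l * l]
    below [8 ^ l]. *)
Lemma rank_free_ge l n : (n <= 8 ^ l)%N -> (n <= rank free n + l * l)%N.
Proof.
elim: l n => [|l IH] n nl.
  case: n nl => [|[|n]]//= _; rewrite rankS /rank big_ord0 /free trunc_log0; lia.
have [/IH|ln] := leqP n (8 ^ l); first by nia.
suff : (n - rank free n <= minn (n - 8 ^ l) l + (8 ^ l - rank free (8 ^ l)))%N.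
  have := IH (8 ^ l)%N (leqnn _); nia.
have -> : n = (8 ^ l + (n - 8 ^ l))%N by lia.
have : (n - 8 ^ l <= 8 ^ l.+1 - 8 ^ l)%N by lia.
elim: (n - 8 ^ l)%N => [|k IHk] kl; first by rewrite addn0; lia.
rewrite addnS rankS.
have := IHk (ltnW kl); have := rank_sub free (8 ^ l + k).
case: (boolP (free (8 ^ l + k))) => [_|]; first by lia.
rewrite /free (_ : trunc_log 8 (8 ^ l + k) = l); last first.
  by apply: trunc_log_eq => //; rewrite leq_addr/= -ltn_subRL; lia.
by lia.
Qed.

(** The number of frozen places below [n] is at most of order [(log n)^2], which is negligible
    against [(1 - s) n]. *)
Lemma rank_free_linear (R : realType) (s C : R) : s < 1 ->
  exists n0, forall n, (n0 <= n)%N -> s * n%:R + C <= (rank free n)%:R.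
Proof.
(* [l0] and [n1] make the number of frozen places and [C] each at most half of [(1 - s) n]. *)
move=> s1; pose l0 := (Num.truncn (2 / (1 - s))).+1.
pose n1 := (Num.truncn (2 * C / (1 - s))).+1.
have l0s : 2 <= (1 - s) * l0%:R.
  by rewrite [leRHS]mulrC -ler_pdivrMr ?subr_gt0// ltW// truncnS_gt.
exists (maxn (8 ^ l0) n1) => n; rewrite geq_max => /andP[l0n n1n].
have Cn : 2 * C <= (1 - s) * n%:R.
  rewrite [leRHS]mulrC -ler_pdivrMr ?subr_gt0//.
  by rewrite (le_trans (ltW (truncnS_gt _)))// ler_nat.
have n0 : (0 < n)%N by apply: leq_trans l0n; rewrite expn_gt0.
have /andP[ln nl] := trunc_log_bounds (isT : (1 < 8)%N) n0.
set l := trunc_log 8 n in ln nl.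
have l0l : (l0 <= l)%N.
  by rewrite -ltnS -(@ltn_exp2l 8)// (leq_ltn_trans l0n).
have zl : (n <= rank free n + l.+1 * l.+1)%N by rewrite rank_free_ge// ltnW.
(* Both [l.+1] and [l0] are at most [2 ^ l], and [8 ^ l] is the cube of [2 ^ l]. *)
have ll : (l.+1 * l.+1 * l0 <= n)%N.
  apply: leq_trans ln; apply: (@leq_trans ((2 ^ l) * (2 ^ l) * (2 ^ l))%N).
    have l2 : (l < 2 ^ l)%N by rewrite ltn_expl.
    by rewrite !leq_mul// (leq_trans l0l)// ltnW.
  by rewrite -!expnMn.
have : (n%:R : R) <= (rank free n)%:R + (l.+1 * l.+1)%:R by rewrite -natrD ler_nat.
have : (l.+1 * l.+1)%:R * l0%:R <= n%:R :> R by rewrite -natrM ler_nat.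
set z : R := (l.+1 * l.+1)%:R => zn nz.
have : 2 * z <= (1 - s) * n%:R.
  apply: (@le_trans _ _ ((1 - s) * (z * l0%:R))); last by rewrite ler_wpM2l// subr_ge0 ltW.
  by rewrite mulrCA mulrC ler_wpM2l.
lra.
Qed.

Lemma rank_unbounded (R : realType) J (s C : R) : 0 < s ->
  (exists n0, forall n, (n0 <= n)%N -> s * n%:R + C <= (rank J n)%:R) ->
  forall k, exists n, (k <= rank J n)%N.
Proof.
move=> s0 [n0 hn] k; pose m := (Num.truncn ((k%:R - C) / s)).+1.
exists (maxn n0 m); rewrite -(ler_nat R).
apply: le_trans (hn _ (leq_maxl _ _)).
rewrite -lerBlDr [leRHS]mulrC -ler_pdivrMr// ltW// (lt_le_trans (truncnS_gt _))//.
by rewrite ler_nat leq_maxr.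
Qed.

(* With [u n = rank J n - floor (s n)] and [v n = min_(N >= n) u N], deleting
   from [J] the places where [v] jumps leaves a set of rank
   [rank J n - v n + v n0], and [u n = v n] infinitely often. *)
Lemma thinning (R : realType) J (s C : R) : 0 < s -> s <= 1 ->
  (forall C' : R, exists n0, forall n, (n0 <= n)%N -> s * n%:R + C' <= (rank J n)%:R) ->
  exists J' n0 (G : R), [/\ forall i, J' i -> J i,
    forall n, (n0 <= n)%N -> s * n%:R + C <= (rank J' n)%:R &
    forall N, exists2 n, (N <= n)%N & (rank J' n)%:R <= s * n%:R + G].
Proof.
move=> s0 s1 hJ; pose h n := Num.truncn (s * n%:R).
have [n0 hn0] := hJ (`|C| + 1).
have h_itv n : (h n)%:R <= s * n%:R < (h n)%:R + 1.
  by rewrite natr1; apply: truncn_itv; rewrite mulr_ge0// ltW.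
pose u n := (rank J n - h n)%N.
have uE n : (n0 <= n)%N -> rank J n = (u n + h n)%N.
  move=> nn; rewrite subnK// -(ler_nat R); have := hn0 _ nn; have := h_itv n.
  by have := normr_ge0 C; lra.
have uC n : (n0 <= n)%N -> C + 1 <= (u n)%:R.
  move=> nn; have := hn0 _ nn; rewrite uE// natrD; have := h_itv n.
  by have := ler_norm C; lra.
have hS n : (h n <= h n.+1)%N.
  by apply: le_truncn; rewrite ler_wpM2l ?ler_nat// ltW.
have exu n : exists k, `[< exists2 N, (n <= N)%N & u N = k >].
  by exists (u n); apply/asboolP; exists n.
pose v n := ex_minn (exu n).
have vE n : exists2 N, (n <= N)%N & u N = v n.
  by rewrite /v; case: ex_minnP => k /asboolP.
have v_le n N : (n <= N)%N -> (v n <= u N)%N.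
  by rewrite /v; case: ex_minnP => k _ + nN; apply; apply/asboolP; exists N.
have vS n : (v n <= v n.+1)%N.
  by have [N nN <-] := vE n.+1; apply: v_le; apply: ltnW.
pose J' i := J i && ((i < n0)%N || (v i.+1 == v i)).
have low n : (n <= n0)%N -> rank J' n = rank J n.
  elim: n => [|n IH] nn; first by rewrite /rank !big_ord0.
  by rewrite !rankS IH 1?ltnW// /J' nn andbT.
have high k : (rank J' (n0 + k) + v (n0 + k) = rank J (n0 + k) + v n0)%N.
  elim: k => [|k IH]; first by rewrite addn0 low.
  have J'E : J' (n0 + k)%N = J (n0 + k)%N && (v (n0 + k).+1 == v (n0 + k)%N).
    by rewrite /J' ltnNge leq_addr.
  rewrite addnS !rankS J'E.
  have [->|ne] := eqVneq; first by rewrite andbT; lia.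
  rewrite andbF /=.
  (* At a jump of [v] the minimum is attained only at [n0 + k]. Since [h] is nondecreasing, [u]
     grows there by at most 1, so the jump is exactly 1 and the place belongs to [J]. *)
  have {}ne : (v (n0 + k) < v (n0 + k).+1)%N by rewrite ltn_neqAle eq_sym ne vS.
  have [N nN uN] := vE (n0 + k)%N.
  have NE : N = (n0 + k)%N.
    apply/eqP; rewrite eqn_leq nN andbT leqNgt; apply/negP => /v_le.
    by rewrite uN leqNgt ne.
  have := v_le (n0 + k).+1 (n0 + k).+1 (leqnn _).
  have := uE (n0 + k).+1 (leq_trans (leq_addr _ _) (leqnSn _)).
  have := uE (n0 + k)%N (leq_addr _ _); have := hS (n0 + k)%N.
  move: IH ne uN; rewrite rankS -NE; case: (J N) => /=; lia.
have v0 : C + 1 <= (v n0)%:R by have [N nN <-] := vE n0; apply: uC.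
exists J', n0, (v n0)%:R; split.
- by move=> i /andP[].
(* Here [rank J' n = h n + (u n - v n) + v n0] with [v n0 >= C + 1]; the extra 1 pays for the floor
   in [h]. *)
- move=> n nn; have := high (n - n0)%N; rewrite subnKC// => hh.
  have : (h n + v n0 <= rank J' n)%N.
    by have := v_le _ _ (leqnn n); have := uE _ nn; lia.
  rewrite -(ler_nat R) natrD; have := h_itv n; lra.
(* A place attaining the minimum [v (maxn n0 N)] has [u n = v n], so its rank is [h n + v n0]. *)
- move=> N; have [n nN un] := vE (maxn n0 N).
  have nn : (n0 <= n)%N by rewrite (leq_trans (leq_maxl _ _) nN).
  exists n; first by rewrite (leq_trans (leq_maxr _ _) nN).
  have := high (n - n0)%N; rewrite subnKC// => hh.
  have vv : v n = u n.
    apply/eqP; rewrite eqn_leq v_le//= un.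
    by have [M nM <-] := vE n; apply: v_le; apply: leq_trans nM.
  have : (rank J' n = h n + v n0)%N by have := uE _ nn; lia.
  by move=> ->; rewrite natrD lerD2r; have := h_itv n; lra.
Qed.

(** * Hausdorff measure *)

Lemma cdist_ge0 (R : realType) (z w : R * R) : 0 <= cdist z w.
Proof. exact: sqrtr_ge0. Qed.

Lemma cdist_ge1 (R : realType) (z w : R * R) : `|z.1 - w.1| <= cdist z w.
Proof. by rewrite -sqrtr_sqr ler_wsqrtr// lerDl sqr_ge0. Qed.

Lemma cdist_ge2 (R : realType) (z w : R * R) : `|z.2 - w.2| <= cdist z w.
Proof. by rewrite -sqrtr_sqr ler_wsqrtr// lerDr sqr_ge0. Qed.

Lemma cdist_le (R : realType) (z w : R * R) :
  cdist z w <= `|z.1 - w.1| + `|z.2 - w.2|.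
Proof.
rewrite -[leRHS]ger0_norm ?addr_ge0// -sqrtr_sqr ler_wsqrtr//.
rewrite -(real_normK (num_real (z.1 - w.1))) -(real_normK (num_real (z.2 - w.2))).
by rewrite sqrrD -addrA lerD2l lerDr mulrn_wge0// mulr_ge0.
Qed.

Lemma ediam_ge0 (R : realType) (B : set (R * R)) : (0 <= ediam B)%E.
Proof. by rewrite /ediam le_max lexx. Qed.

Lemma cdist_le_ediam (R : realType) (B : set (R * R)) z w :
  B z -> B w -> ((cdist z w)%:E <= ediam B)%E.
Proof.
move=> Bz Bw; rewrite /ediam le_max; apply/orP; right.
by apply: ereal_sup_ubound; exists z, w.
Qed.

Lemma ediam_le (R : realType) (B : set (R * R)) (d : R) : 0 <= d ->
  (forall z w, B z -> B w -> cdist z w <= d) -> (ediam B <= d%:E)%E.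
Proof.
move=> d0 Bd; rewrite /ediam ge_max lee_fin d0/=.
by apply: ge_ereal_sup => _ [z [w [Bz Bw ->]]]; rewrite lee_fin Bd.
Qed.

Lemma ediam_fine (R : realType) (B : set (R * R)) (e : R) :
  (ediam B < e%:E)%E -> exists d : R, [/\ 0 <= d, d < e & ediam B = d%:E].
Proof.
have := ediam_ge0 R B; case: (ediam B) => [d||]//.
by rewrite lee_fin lte_fin => d0 de; exists d.
Qed.

Lemma content_ge0 (R : realType) (s e : R) (E : set (R * R)) :
  (0 <= hausdorff_content s e E)%E.
Proof.
apply: le_ereal_inf_tmp => _ [D [B [_ ->]]].
by apply: esum_ge0 => k _; exact: poweR_ge0.
Qed.

Lemma content_le (R : realType) (s e e' : R) (E F : set (R * R)) :
  e <= e' -> F `<=` E -> (hausdorff_content s e' F <= hausdorff_content s e E)%E.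
Proof.
move=> ee' FE; apply: ereal_inf_le_tmp => _ [D [B [[EB Be] ->]]].
exists D, B; split=> //; split; first exact: subset_trans EB.
by move=> k /Be/lt_le_trans; apply; rewrite lee_fin.
Qed.

(** The content grows as the mesh shrinks, so its right limit at 0 is a supremum. *)
Lemma hausdorff_measureE (R : realType) (s : R) (E : set (R * R)) :
  hausdorff_measure s E =
  ereal_sup [set hausdorff_content s e E | e in [set e : R | 0 < e]].
Proof.
have := @nonincreasing_at_right_cvge R (fun e => hausdorff_content s e E) 0
  (BInfty _ false).
rewrite bnd_simp => /(_ isT) h; rewrite /hausdorff_measure.
rewrite (cvg_lim (@ereal_hausdorff R) (h _)).
  by congr ereal_sup; apply/seteqP; split=> _ [e /= e0 <-]; exists e => //;
    move: e0; rewrite in_itv/= andbT.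
by move=> x y _ _ xy; apply: content_le.
Qed.

Lemma content_le_hm (R : realType) (s e : R) (E : set (R * R)) : 0 < e ->
  (hausdorff_content s e E <= hausdorff_measure s E)%E.
Proof.
by move=> e0; rewrite hausdorff_measureE; apply: ereal_sup_ubound; exists e.
Qed.

Lemma hm_le (R : realType) (s : R) (E : set (R * R)) (x : \bar R) :
  (forall e : R, (0 < e)%R -> hausdorff_content s e E <= x)%E ->
  (hausdorff_measure s E <= x)%E.
Proof.
by move=> h; rewrite hausdorff_measureE; apply: ge_ereal_sup => _ [e /= e0 <-]; exact: h.
Qed.

Lemma hm_ge0 (R : realType) (s : R) (E : set (R * R)) :
  (0 <= hausdorff_measure s E)%E.
Proof. exact: le_trans (content_ge0 R s 1 E) (content_le_hm R s 1 E ltr01). Qed.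

Lemma hm_mono (R : realType) (s : R) (E F : set (R * R)) : F `<=` E ->
  (hausdorff_measure s F <= hausdorff_measure s E)%E.
Proof.
move=> FE; apply: hm_le => e e0.
exact: le_trans (content_le R s e e E F (lexx _) FE) (content_le_hm R s e E e0).
Qed.

(** Nearly optimal covers of the two sets are interleaved on even and odd indices. *)
Lemma content_setU (R : realType) (s e : R) (E F : set (R * R)) :
  (hausdorff_content s e (E `|` F) <=
     hausdorff_content s e E + hausdorff_content s e F)%E.
Proof.
have [->|Efin] := eqVneq (hausdorff_content s e E) +oo%E.
  by rewrite addye ?leey// -ltNye (lt_le_trans _ (content_ge0 _ _ _ _))// ltNy0.
have [->|Ffin] := eqVneq (hausdorff_content s e F) +oo%E.
  by rewrite addey ?leey// -ltNye (lt_le_trans _ (content_ge0 _ _ _ _))// ltNy0.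
have {}Efin : hausdorff_content s e E \is a fin_num.
  by rewrite ge0_fin_numE ?content_ge0// ltey.
have {}Ffin : hausdorff_content s e F \is a fin_num.
  by rewrite ge0_fin_numE ?content_ge0// ltey.
apply/lee_addgt0Pr => _/posnumP[eta].
have e2 : 0 < eta%:num / 2 by rewrite divr_gt0.
have [_ [D1 [B1 [[EB1 B1e] ->]]] lt1] := lb_ereal_inf_adherent e2 Efin.
have [_ [D2 [B2 [[FB2 B2e] ->]]] lt2] := lb_ereal_inf_adherent e2 Ffin.
pose D := [set k.*2 | k in D1] `|` [set k.*2.+1 | k in D2].
pose B k := if odd k then B2 k./2 else B1 k./2.
have B_even k : B k.*2 = B1 k by rewrite /B odd_double doubleK.
have B_odd k : B k.*2.+1 = B2 k by rewrite /B /= odd_double /= uphalf_double.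
apply: (@le_trans _ _ (\esum_(k in D) (ediam (B k) `^ s))%E).
  apply: ereal_inf_lbound; exists D, B; split=> //; split.
    move=> z [/EB1[k D1k B1z]|/FB2[k D2k B2z]].
      by exists k.*2; [left; exists k|rewrite B_even].
    by exists k.*2.+1; [right; exists k|rewrite B_odd].
  by move=> _ [[k D1k <-]|[k D2k <-]]; rewrite ?B_even ?B_odd; auto.
rewrite (esumID [set k | odd k]); last by move=> k _; exact: poweR_ge0.
have -> : D `&` [set k | odd k] = [set k.*2.+1 | k in D2].
  apply/seteqP; split=> [_ [[[k D1k <-]|[k D2k <-]]]|_ [k D2k <-]] //=.
  - by rewrite odd_double.
  - by exists k.
  - by split; [right; exists k|rewrite /= odd_double].
have -> : D `&` ~` [set k | odd k] = [set k.*2 | k in D1].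
  apply/seteqP; split=> [_ [[[k D1k <-]|[k D2k <-]]]|_ [k D2k <-]] //=.
  - by exists k.
  - by rewrite odd_double.
  - by split; [left; exists k|rewrite /= odd_double].
rewrite !esum_image; first last.
- by move=> k l _ _ [] /double_inj.
- by move=> k l _ _ /double_inj.
rewrite (eq_esum (b := fun k => (ediam (B2 k) `^ s)%E)); last by move=> k _; rewrite B_odd.
rewrite [X in (_ + X)%E](eq_esum (b := fun k => (ediam (B1 k) `^ s)%E)); last first.
  by move=> k _; rewrite B_even.
rewrite addeC (le_trans (leeD (ltW lt1) (ltW lt2)))// addeACA.
by rewrite -EFinD -splitr.
Qed.

Lemma hm_setU (R : realType) (s : R) (E F : set (R * R)) :
  (hausdorff_measure s (E `|` F) <= hausdorff_measure s E + hausdorff_measure s F)%E.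
Proof.
apply: hm_le => e e0; apply: le_trans (content_setU _ _ _ _ _) _.
by apply: leeD; exact: content_le_hm.
Qed.

Lemma content_finite (R : realType) (s e d : R) (E : set (R * R)) n
    (B : nat -> set (R * R)) : 0 <= s -> 0 <= d -> d < e ->
  E `<=` \bigcup_(k in `I_n) B k ->
  (forall k z w, B k z -> B k w -> cdist z w <= d) ->
  (hausdorff_content s e E <= (n%:R * d `^ s)%:E)%E.
Proof.
move=> s0 d0 de EB Bd.
apply: (@le_trans _ _ (\esum_(k in `I_n) (ediam (B k) `^ s))%E).
  apply: ereal_inf_lbound; exists `I_n, B; split=> //; split=> // k _.
  by apply: le_lt_trans (ediam_le _ _ _ d0 (Bd k)) _; rewrite lte_fin.
rewrite esum_fset// => [|k _]; last exact: poweR_ge0.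
rewrite -fsbig_ord (@le_trans _ _ (\sum_(k < n) (d `^ s)%:E)%E)//.
  apply: lee_sum => k _; rewrite -poweR_EFin; apply: gt0_ler_poweR => //.
  - by rewrite in_itv/= ediam_ge0 leey.
  - by rewrite in_itv/= lee_fin d0 leey.
  - exact: ediam_le (Bd k).
by rewrite sumEFin sumr_const card_ord mulr_natl.
Qed.

Lemma esum_scale (R : realType) (T : choiceType) (D : set T) (a b : T -> \bar R)
    (l : R) : 0 <= l -> (forall i, (0 <= b i)%E) ->
  (forall i, D i -> a i <= l%:E * b i)%E ->
  (\esum_(i in D) a i <= l%:E * \esum_(i in D) b i)%E.
Proof.
move=> l0 b0 ab; apply: ge_ereal_sup => _ [X [finX XD] <-].
apply: (@le_trans _ _ (\sum_(i \in X) (l%:E * b i))%E).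
  by apply: lee_fsum => // i /XD/ab.
rewrite -ge0_mule_fsumr// lee_wpmul2l ?lee_fin//.
by apply: ereal_sup_ubound; exists X.
Qed.

(** On a cover with diameters [d < e], [d ^ t <= e ^ (t - s) * d ^ s]; then [e] tends to 0. *)
Lemma hm_dim_gt (R : realType) (s t : R) (E : set (R * R)) :
  0 <= s -> s < t -> (hausdorff_measure s E < +oo)%E -> hausdorff_measure t E = 0%E.
Proof.
move=> s0 st Efin; apply/eqP; rewrite eq_le hm_ge0 andbT.
have ts : 0 < t - s by rewrite subr_gt0.
have t0 : 0 < t by exact: le_lt_trans st.
have key e : 0 < e ->
    (hausdorff_content t e E <= (e `^ (t - s))%:E * (hausdorff_measure s E + 1))%E.
  move=> e0.
  have cs := content_le_hm R s e E e0.
  have cfin : hausdorff_content s e E \is a fin_num.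
    by rewrite ge0_fin_numE ?content_ge0// (le_lt_trans cs).
  have [_ [D [B [[EB Be] ->]]] ltM] := lb_ereal_inf_adherent ltr01 cfin.
  apply: (@le_trans _ _ (\esum_(k in D) (ediam (B k) `^ t))%E).
    by apply: ereal_inf_lbound; exists D, B.
  apply: (@le_trans _ _ ((e `^ (t - s))%:E * \esum_(k in D) (ediam (B k) `^ s))%E).
    apply: esum_scale => [|k|k /Be/ediam_fine[d [d0 de ->]]].
    - exact: powR_ge0.
    - exact: poweR_ge0.
    - rewrite !poweR_EFin lee_fin; have [->|dn0] := eqVneq d 0.
        by rewrite powR0 ?gt_eqF// mulr_ge0// powR_ge0.
      rewrite -[in leLHS](subrK s t) (@powRD _ d); last by rewrite dn0 implybT.
      rewrite ler_wpM2r ?powR_ge0//.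
      by apply: ge0_ler_powR; rewrite ?nnegrE ?d0 ?(ltW ts) ?(ltW e0) ?(ltW de).
  rewrite lee_wpmul2l ?lee_fin ?powR_ge0//.
  by apply: ltW; apply: lt_le_trans ltM _; apply: leeD.
apply: hm_le => e e0; apply/lee_addgt0Pr => eta eta0; rewrite add0e.
have Mfin : hausdorff_measure s E \is a fin_num by rewrite ge0_fin_numE ?hm_ge0.
have := hm_ge0 R s E; move: key; rewrite -(fineK Mfin) => key M0.
set M := fine _ in key M0; rewrite lee_fin in M0.
have M1 : 0 < M + 1 by rewrite ltr_wpDl.
(* The second bound makes [e' ^ (t - s) * (M + 1)] at most [eta]; the 1 is the error allowed to the
   cover. *)
pose e' := Num.min e ((eta / (M + 1)) `^ (t - s)^-1).
have em : 0 < eta / (M + 1) by rewrite divr_gt0.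
have e'0 : 0 < e' by rewrite lt_min e0 powR_gt0.
apply: (@le_trans _ _ (hausdorff_content t e' E)).
  by apply: content_le => //; rewrite ge_min lexx.
apply: le_trans (key _ e'0) _; rewrite -EFinD -EFinM lee_fin -ler_pdivlMr//.
have -> : eta / (M + 1) = ((eta / (M + 1)) `^ (t - s)^-1) `^ (t - s).
  by rewrite -powRrM mulVf ?gt_eqF// powRr1// ltW.
apply: ge0_ler_powR; rewrite ?nnegrE ?powR_ge0 ?(ltW ts) ?(ltW e'0)//.
by rewrite ge_min lexx orbT.
Qed.

Lemma hausdorff_dim_eq (R : realType) (s : R) (E : set (R * R)) : 0 <= s ->
  (forall t, s < t -> hausdorff_measure t E = 0%E) ->
  (forall t, 0 <= t -> t < s -> hausdorff_measure t E <> 0%E) ->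
  hausdorff_dim E = s%:E.
Proof.
move=> s0 gts lts; apply/eqP; rewrite eq_le; apply/andP; split.
  apply/lee_addgt0Pr => e e0; rewrite -EFinD.
  apply: ereal_inf_lbound; exists (s + e) => //=.
  by split; [rewrite addr_ge0// ltW|apply: gts; rewrite ltrDl].
apply: le_ereal_inf_tmp => _ [t [t0 Ht] <-]; rewrite lee_fin leNgt.
by apply/negP => /(lts _ t0).
Qed.

(** * Hausdorff measure of products of slabs *)

Definition slab (R : realType) J (t t' : R) : set R :=
  [set pt R J b | b in [set b | t <= stair R J b <= t']].

(** Products of pieces from [slab_cover] have diameter at most [2 * hpow R n], and [2 ^ s <= 4]. *)
Lemma slab_content (R : realType) J (s e t1 t1' t2 t2' : R) n :
  0 <= s -> s <= 2 -> 0 <= t1 -> t1 <= t1' -> 0 <= t2 -> t2 <= t2' ->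
  2 * hpow R n < e ->
  (hausdorff_content s e (slab R J t1 t1' `*` slab R J t2 t2') <=
   (4 * (((2 ^ rank J n)%:R * (t1' - t1) + 3) * ((2 ^ rank J n)%:R * (t2' - t2) + 3))
      * hpow R n `^ s)%:E)%E.
Proof.
move=> s0 s2 t10 t1t t20 t2t ne.
have [N1 [S1 [N1le cov1 diam1]]] := slab_cover R J n t1 t1' t10 t1t.
have [N2 [S2 [N2le cov2 diam2]]] := slab_cover R J n t2 t2' t20 t2t.
set M : R := (2 ^ rank J n)%:R in N1le N2le *.
(* Pairs of pieces are numbered by quotient and remainder modulo [N2]. *)
pose B k := S1 (k %/ N2)%N `*` S2 (k %% N2)%N.
have h0 := hpow_gt0 R n.
have d0 : 0 <= 2 * hpow R n by rewrite mulr_ge0// ltW.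
have := content_finite R s e _ (slab R J t1 t1' `*` slab R J t2 t2') (N1 * N2) B s0 d0 ne.
move=> /(_ _ _)/le_trans; apply.
- move=> [_ _] [/= [b /cov1[j jN Sj] <-] [b' /cov2[l lN Sl] <-]].
  exists (j * N2 + l)%N => /=.
    rewrite (@leq_trans (j.+1 * N2))//; last by rewrite leq_mul2r jN orbT.
    by rewrite mulSn addnC ltn_add2r.
  have N20 : (0 < N2)%N by case: N2 lN {N2le cov2 B}.
  by rewrite /B divnMDl// divn_small// addn0 modnMDl modn_small.
- move=> k z w [z1 z2] [w1 w2]; apply: le_trans (cdist_le _ _ _) _.
  by rewrite mulrC mulr_natr mulr2n lerD//; [apply: diam1 z1 w1|apply: diam2 z2 w2].
rewrite lee_fin natrM powRM ?(ltW h0)// mulrA ler_wpM2r ?powR_ge0//.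
rewrite mulrC ler_pM ?mulr_ge0 ?powR_ge0//; last by rewrite ler_pM.
by rewrite (_ : 4 = 2 `^ 2%:R) ?ler_powR ?ler1n// powR_mulrn// -natrX.
Qed.

Lemma hpow_powR_small (R : realType) (s eta : R) : 0 < s -> 0 < eta ->
  exists N, forall n, (N <= n)%N -> hpow R n `^ s < eta.
Proof.
move=> s0 eta0; have [N hN] := hpow_lt R _ (powR_gt0 s^-1 eta0).
exists N => n /(hpow_le R) nN.
have -> : eta = (eta `^ s^-1) `^ s by rewrite -powRrM mulVf ?gt_eqF// powRr1// ltW.
by rewrite gt0_ltr_powR ?nnegrE ?powR_ge0 ?(ltW (hpow_gt0 _ _))// (le_lt_trans nN).
Qed.

(** Let [M = 2 ^ rank J n] and [q = hpow R n ^ s]. At the scales of the hypothesis [M q <= 2 ^ G];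
    the main term of [slab_content] is of order [(M q)^2 (t' - t)], and the rest has a spare factor
    [q] tending to 0. *)
Lemma slab_hm (R : realType) J (s G : R) : 0 < s -> s <= 1 ->
  (forall N, exists2 n, (N <= n)%N & (rank J n)%:R <= s * n%:R + G) ->
  exists2 L : R, 0 < L & forall t t', 0 <= t -> t <= t' ->
    (hausdorff_measure (2 * s) (slab R J t t' `*` slab R J 0 1) <= (L * (t' - t))%:E)%E.
Proof.
move=> s0 s1 hG; pose A : R := 2 `^ G.
have A0 : 0 < A by rewrite powR_gt0.
exists (16 * A ^+ 2); first by rewrite mulr_gt0// exprn_gt0.
move=> t t' t0 tt'; apply: hm_le => e e0; apply/lee_addgt0Pr => eta eta0.
(* The remainder is [16 * 3 * M * q * q <= 48 * A * q], whence 48. *)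
have [N1 hN1] := hpow_powR_small R s (eta / (48 * A)) s0 (divr_gt0 eta0 (mulr_gt0 (ltr0n _ 48) A0)).
have [N2 hN2] : exists N, forall n, (N <= n)%N -> 2 * hpow R n < e.
  have [N hN] := hpow_lt R (e / 2) (divr_gt0 e0 (ltr0n _ 2)).
  by exists N => n /(hpow_le R) nN; rewrite mulrC -ltr_pdivlMr// (le_lt_trans nN).
have [n nN hn] := hG (maxn N1 N2).
move: nN; rewrite geq_max => /andP[/hN1 small /hN2 ne].
have s2 : 2 * s <= 2 by rewrite -[leRHS]mulr1 ler_pM2l.
apply: le_trans (slab_content R J _ _ _ _ _ _ n (mulr_ge0 (ler0n _ 2) (ltW s0))
  s2 t0 tt' (lexx _) ler01 ne) _.
rewrite -EFinD lee_fin subr0 mulr1 mulrC [2 * s]mulrC powRrM powR_mulrn ?powR_ge0//.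
set q := hpow R n `^ s in small *.
set M : R := (2 ^ rank J n)%:R.
have q0 : 0 < q by rewrite powR_gt0 ?hpow_gt0.
have M1 : 1 <= M by rewrite ler1n expn_gt0.
have MqA : M * q <= A.
  rewrite /M /q natrX -powR_mulrn// hpow_powR -powRrM -powRD; last by rewrite pnatr_eq0 implybT.
  by rewrite ler_powR ?ler1n//; lra.
have Mq0 : 0 < M * q by rewrite mulr_gt0// (lt_le_trans _ M1).
have h1 : (M * q) ^+ 2 <= A ^+ 2 by rewrite ler_sqr ?nnegrE ?(ltW A0) ?(ltW Mq0).
have h2 : M * q * q <= A * q by rewrite ler_pM2r.
have h3 : A * q <= eta / 48.
  have : q * (48 * A) < eta by rewrite -ltr_pdivlMr// mulr_gt0.
  by lra.
have tt0 : 0 <= t' - t by rewrite subr_ge0.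
have X0 : 0 <= M * (t' - t) + 3 by rewrite addr_ge0// mulr_ge0// (le_trans _ M1).
apply: (@le_trans _ _ (q ^+ 2 * (4 * ((M * (t' - t) + 3) * (4 * M))))).
  by rewrite ler_wpM2l ?sqr_ge0// ler_pM2l// ler_wpM2l//; lra.
have -> : q ^+ 2 * (4 * ((M * (t' - t) + 3) * (4 * M))) =
  16 * ((M * q) ^+ 2 * (t' - t) + 3 * (M * q * q)) by ring.
have : (M * q) ^+ 2 * (t' - t) <= A ^+ 2 * (t' - t) by rewrite ler_wpM2r.
by rewrite -[16 * A ^+ 2 * _]mulrA; lra.
Qed.

Lemma cant_slab (R : realType) J (t : R) : cant R J t = slab R J 0 t.
Proof.
apply/seteqP; split=> _ [b /= bt <-]; exists b => //=.
  by rewrite bt andbT; have /andP[] := stair_itv R J b.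
by have /andP[] := bt.
Qed.

Lemma lebesgue_centered (R : realType) (a r : R) : 0 <= r ->
  lebesgue_measure (`[a - r, a + r]%classic : set R) = (2 * r)%:E.
Proof.
move=> r0; rewrite lebesgue_measure_itv/= lte_fin.
case: ltP => [_|]; first by rewrite -EFinB; congr EFin; ring.
by move=> h; congr EFin; lra.
Qed.

Lemma m2_setX (R : realType) (A B : set R) : measurable A -> measurable B ->
  m2 (A `*` B) = (lebesgue_measure A * lebesgue_measure B)%E.
Proof. by move=> mA mB; rewrite /m2 product_measure1E. Qed.

(* The pair of staircases maps the set onto the unit square and sends a set of
   diameter d into a square of side 8 kappa d^s. *)
Lemma hm_lower (R : realType) J (s kappa : R) n0 : 0 < s -> s <= 1 ->
  0 < kappa -> (forall k, exists n, (k <= rank J n)%N) ->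
  (forall n, (n0 <= n)%N -> hpow R (rank J n) <= kappa * hpow R n `^ s) ->
  (((64 * kappa ^+ 2)^-1)%:E <=
    hausdorff_measure (2 * s) (cant R J 1 `*` cant R J 1))%E.
Proof.
move=> s0 s1 k0 unb hk.
apply: le_trans (content_le_hm R (2 * s) (hpow R n0) _ (hpow_gt0 R n0)).
apply: le_ereal_inf_tmp => _ [D [B [[EB Be] ->]]].
have c0 : 0 < 64 * kappa ^+ 2 by rewrite mulr_gt0// exprn_gt0.
(* [Q] is a square catching the staircase values of all points of the product in [B k], or is empty
   if there are none to catch. *)
have ex k : exists Q : set (R * R), [/\ measurable Q,
    (m2 Q <= (64 * kappa ^+ 2)%:E * (if k \in D then ediam (B k) `^ (2 * s) else 0))%E &
    D k -> forall b b', B k (pt R J b, pt R J b') -> Q (stair R J b, stair R J b')].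
  have [Dk|Dk] := pselect (D k); last first.
    exists set0; split => //; rewrite /m2 measure0 mule_ge0 ?lee_fin ?(ltW c0)//.
    by case: ifP => // _; exact: poweR_ge0.
  rewrite mem_set//; have [d [d0 dn de]] := ediam_fine R _ _ (Be _ Dk).
  have [[[b0 b0'] Bb]|no] := pselect (exists bb : (nat -> bool) * (nat -> bool), B k (pt R J bb.1, pt R J bb.2)); last first.
    exists set0; split => //.
      by rewrite /m2 measure0 mule_ge0 ?lee_fin ?(ltW c0)// poweR_ge0.
    by move=> _ b b' Bb; apply: no; exists (b, b').
  pose r := 4 * kappa * d `^ s.
  have r0 : 0 <= r by rewrite !mulr_ge0 ?powR_ge0// ltW.
  exists (`[stair R J b0 - r, stair R J b0 + r]%classic `*` `[stair R J b0' - r, stair R J b0' + r]%classic).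
  split; first exact: measurableX.
    rewrite m2_setX// !lebesgue_centered// de poweR_EFin -!EFinM lee_fin.
    have -> : d `^ (2 * s) = (d `^ s) ^+ 2 by rewrite mulrC powRrM powR_mulrn ?powR_ge0.
    by rewrite /r le_eqVlt; apply/orP; left; apply/eqP; ring.
  move=> _ b b' Bb'.
  have dist : cdist (pt R J b, pt R J b') (pt R J b0, pt R J b0') <= d.
    by have := cdist_le_ediam R _ _ _ Bb' Bb; rewrite de lee_fin.
  have near a a0 : `|pt R J a - pt R J a0| <= d -> `|stair R J a - stair R J a0| <= r.
    move=> ad; apply: le_trans (pt_holder R J s kappa n0 s0 s1 (ltW k0) hk a a0 (le_lt_trans ad dn)) _.
    by rewrite ler_wpM2l ?mulr_ge0 ?(ltW k0)// ge0_ler_powR ?nnegrE// ltW.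
  have := near _ _ (le_trans (cdist_ge1 _ _ _) dist).
  have := near _ _ (le_trans (cdist_ge2 _ _ _) dist).
  by rewrite !ler_norml => /= ? ?; split; rewrite /= in_itv/=; apply/andP; split; lra.
have [Q hQ] := choice ex.
pose I : set (R * R) := `[0, 1]%classic `*` `[0, 1]%classic.
have e1 : m2 I = 1%E.
  rewrite m2_setX// lebesgue_measure_itv/= lte_fin ltr01.
  by rewrite sube0 mule1.
have cov : I `<=` \bigcup_k Q k.
  move=> [u v] [/=]; rewrite !in_itv/= => u01 v01.
  have [b <-] := stair_surj R J u unb u01; have [b' <-] := stair_surj R J v unb v01.
  have : (cant R J 1 `*` cant R J 1) (pt R J b, pt R J b').
    by split=> /=; [exists b|exists b'] => //=; have /andP[] := stair_itv R J b;
      have /andP[] := stair_itv R J b'.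
  by move=> /EB[k Dk Bk]; exists k => //; have [_ _] := hQ k; apply.
have : (m2 I <= \sum_(k <oo) m2 (Q k))%E.
  apply: measure_sigma_subadditive => //; first by move=> k; have [] := hQ k.
  exact: measurableX.
rewrite e1 nneseries_esumT// => le1.
have : (1%E <= (64 * kappa ^+ 2)%:E * \esum_(k in D) (ediam (B k) `^ (2 * s)))%E.
  rewrite esum_mkcond; apply: (le_trans le1); apply: esum_scale => [|k|k _].
  - exact: ltW.
  - by case: ifP => // _; exact: poweR_ge0.
  - by have [] := hQ k.
by rewrite -lee_pdivrMl// mule1.
Qed.

Lemma lipschitz_continuous_real (R : realType) (f : R -> R) (L : R) :
  (forall x y, x <= y -> `|f y - f x| <= L * (y - x)) -> continuous f.
Proof.
move=> lip x; apply/cvgrPdist_lt => e e0.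
have L0 : 0 < `|L| + 1 by rewrite ltr_wpDl.
near=> y.
have h : `|f x - f y| <= L * `|x - y|.
  have [xy|/ltW yx] := leP x y; last by rewrite [`|x - y|]ger0_norm ?subr_ge0// lip.
  by rewrite distrC [`|x - y|]distrC [`|y - x|]ger0_norm ?subr_ge0// lip.
apply: (le_lt_trans h); apply: (@le_lt_trans _ _ ((`|L| + 1) * `|x - y|)).
  by rewrite ler_wpM2r// (le_trans (ler_norm L))// lerDl.
rewrite mulrC -ltr_pdivlMr//; near: y.
by apply: cvgr_dist_lt; rewrite ?divr_gt0//; exact: cvg_id.
Unshelve. all: by end_near. Qed.

(** A digit string on [J'] becomes one on [J] by filling in zeros. *)
Lemma cant_sub (R : realType) J J' (t : R) : (forall i, J' i -> J i) ->
  cant R J' t `<=` cant R J 1.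
Proof.
move=> JJ' _ [b _ <-]; exists (restr J' b).
  by rewrite /=; have /andP[] := stair_itv R J (restr J' b).
congr stair; apply/funext => i; rewrite /restr.
by case: (boolP (J' i)) => [/JJ' ->|_]; rewrite ?andbF.
Qed.

Lemma exists_subset (R : realType) J (s c : R) : 0 < s -> s <= 1 -> 0 < c ->
  (forall C : R, exists n0, forall n, (n0 <= n)%N -> s * n%:R + C <= (rank J n)%:R) ->
  exists K : set (R * R), [/\ K `<=` cant R J 1 `*` cant R J 1, compact K &
    hausdorff_measure (2 * s) K = c%:E].
Proof.
move=> s0 s1 c0 hJ.
have c1 : 0 < 1 + c by rewrite addr_gt0.
(* Then [64 * kappa0 ^ 2 = (1 + c) ^ -2], so [hm_lower] will give at least [(1 + c) ^ 2 >= c]. *)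
pose kappa0 : R := (8 * (1 + c))^-1.
have kappa00 : 0 < kappa0 by rewrite invr_gt0 mulr_gt0.
have [C hC] := hpow_lt R kappa0 kappa00.
(* Rank at least [s n + C] means [hpow R (rank J' n) <= hpow R C * hpow R n ^ s], so [hpow R C]
   serves as [kappa]. *)
have [J' [n0 [G [JJ' lo hi]]]] := thinning R J s C%:R s0 s1 hJ.
have unb : forall k, exists n, (k <= rank J' n)%N.
  by apply: (rank_unbounded R J' s C%:R s0); exists n0.
have [L L0 slabL] := slab_hm R J' s G s0 s1 hi.
pose K t := cant R J' t `*` cant R J' 1.
pose H t := hausdorff_measure (2 * s) (K t).
have K0 t : t < 0 -> K t = set0.
  move=> t0; rewrite -subset0 => -[x y] [/= [b bt _] _].
  by have /andP[+ _] := stair_itv R J' b; move: bt => /= /le_lt_trans/(_ t0); case: leP.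
(* The part added between heights [t] and [t'] lies in a slab. Since [slab_hm] is for nonnegative
   heights, negative ones, where [K t] is empty, are treated apart. *)
have Hlip t t' : t <= t' -> (H t' <= H t + (L * (t' - t))%:E)%E.
  move=> tt'; have [t0|t0] := leP 0 t.
    apply: (@le_trans _ _ (hausdorff_measure (2 * s) (K t `|` slab R J' t t' `*` slab R J' 0 1))).
      apply: hm_mono => -[x y] [/= [b bt' <-] yB].
      have [bt|bt] := leP (stair R J' b) t; [left|right]; split=> //=.
      - by exists b.
      - by exists b => //=; rewrite (ltW bt).
      - by rewrite -cant_slab.
    apply: le_trans (hm_setU _ _ _ _) _; rewrite leeD2l//; exact: slabL.
  have [t'0|t'0] := leP 0 t'.
    apply: le_trans (_ : (L * (t' - 0))%:E <= _)%E.
      by rewrite /H /K !cant_slab; exact: slabL.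
    rewrite -[leLHS]add0e leeD ?hm_ge0// lee_fin ler_wpM2l ?(ltW L0)//; lra.
  have -> : H t' = H t by rewrite /H !K0.
  by rewrite leeDl// lee_fin mulr_ge0 ?(ltW L0)// subr_ge0.
have H0 : H 0 = 0%E.
  apply/eqP; rewrite eq_le hm_ge0 andbT.
  by have := slabL 0 0 (lexx _) (lexx _); rewrite subrr mulr0 /H /K !cant_slab.
have Hfin t : H t \is a fin_num.
  rewrite ge0_fin_numE ?hm_ge0//; have [t0|t0] := leP 0 t.
    by apply: le_lt_trans (Hlip 0 t t0) _; rewrite H0 add0e ltry.
  rewrite /H K0//; apply: le_lt_trans (hm_mono _ _ _ _ (sub0set (K 0))) _.
  by rewrite -/(H 0) H0 ltry.
have Hmono t t' : t <= t' -> (H t <= H t')%E.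
  move=> tt'; apply: hm_mono => -[x y] [/= [b bt bx] yB]; split=> //.
  by exists b => //=; exact: le_trans tt'.
have cont : continuous (fun t => fine (H t)).
  apply: (lipschitz_continuous_real R _ L) => x y xy.
  have := Hlip _ _ xy; have := Hmono _ _ xy.
  rewrite -(fineK (Hfin x)) -(fineK (Hfin y)) -EFinD !lee_fin /=.
  by rewrite ler_norml; lra.
have H1 : (c%:E <= H 1%R)%E.
  have hC0 := hpow_gt0 R C.
  apply: le_trans (hm_lower R J' s (hpow R C) n0 s0 s1 hC0 unb _).
    rewrite lee_fin -[leLHS]invrK lef_pV2 ?posrE ?invr_gt0 ?mulr_gt0 ?exprn_gt0//.
    apply: (@le_trans _ _ (64 * kappa0 ^+ 2)).
      by rewrite ler_pM2l// ler_sqr ?nnegrE ?ltW.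
    rewrite /kappa0 exprVn exprMn invfM mulrA -[8 ^+ 2]natrX divff// mul1r.
    by rewrite lef_pV2 ?posrE ?exprn_gt0//; rewrite expr2; nra.
  move=> n /lo nn; rewrite !hpow_powR -powRrM -powRD; last by rewrite pnatr_eq0 implybT.
  by rewrite ler_powR ?ler1n//; lra.
have [t _ Ht] : exists2 t, t \in `[0, 1] & fine (H t) = c.
  apply: IVT => //; first exact: continuous_subspaceT.
  rewrite H0 /= ge_min (ltW c0)/= le_max; apply/orP; right.
  by rewrite -lee_fin fineK.
exists (K t); split.
- by apply: setSX; apply: cant_sub => // i; exact: JJ'.
- by apply: compact_setX; exact: cant_compact.
- by rewrite -Ht fineK.
Qed.

(** * Vanishing of the area and of two-dimensional Hausdorff measure *)

Lemma pow2_rank (R : realType) J n k : (rank J n + k <= n)%N ->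
  (2 ^ rank J n)%:R * hpow R n <= hpow R k.
Proof.
move=> rn; apply: (@le_trans _ _ ((2 ^ rank J n)%:R * hpow R (rank J n + k))).
  by rewrite ler_wpM2l// hpow_le.
by rewrite /hpow exprD mulrA [X in X * _]mulrC hpow_natV mul1r.
Qed.

Lemma cant_hm2 (R : realType) J :
  (forall k, exists n, (rank J n + k <= n)%N) ->
  hausdorff_measure 2 (cant R J 1 `*` cant R J 1) = 0%E.
Proof.
move=> defect; apply/eqP; rewrite eq_le hm_ge0 andbT.
apply: hm_le => e e0; apply/lee_addgt0Pr => eta eta0; rewrite add0e.
(* The three bounds ensure fineness, let a square be replaced by its base, and absorb the factor
   [4 * 4 ^ 2]. *)
have m0 : 0 < Num.min (e / 2) (Num.min 1 (eta / 64)) by rewrite !lt_min !divr_gt0//= ltr01.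
have [k] := hpow_lt R _ m0; rewrite !lt_min => /and3P[ke k1 keta].
have [n kn] := defect k.
have hnk : hpow R n <= hpow R k by apply: hpow_le; lia.
have ne : 2 * hpow R n < e by lra.
rewrite !cant_slab.
apply: le_trans (slab_content R J 2 e 0 1 0 1 n (ler0n _ _) (lexx _) (lexx _) ler01 (lexx _) ler01 ne) _.
rewrite lee_fin subr0 mulr1 powR_mulrn ?(ltW (hpow_gt0 _ _))//.
have := pow2_rank R J n k kn; set M : R := (2 ^ rank J n)%:R => MK.
have M0 : 0 <= M by [].
have h0 := hpow_gt0 R n; have k0 := hpow_gt0 R k.
have -> : 4 * ((M + 3) * (M + 3)) * hpow R n ^+ 2 = 4 * (M * hpow R n + 3 * hpow R n) ^+ 2 by ring.
have : (M * hpow R n + 3 * hpow R n) ^+ 2 <= (4 * hpow R k) ^+ 2.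
  by rewrite ler_sqr ?nnegrE; nra.
have : hpow R k ^+ 2 <= hpow R k by rewrite expr2 ler_piMl// ltW.
by rewrite exprMn; nra.
Qed.

Lemma cant_measurable (R : realType) J (t : R) :
  (forall k, exists n, (k <= rank J n)%N) -> measurable (cant R J t).
Proof. by move=> /cant_compact -/(_ R t); exact: compact_measurable. Qed.

Lemma cant_null (R : realType) J :
  (forall k, exists n, (k <= rank J n)%N) ->
  (forall k, exists n, (rank J n + k <= n)%N) ->
  lebesgue_measure (cant R J 1) = 0%E.
Proof.
move=> unb defect; apply/eqP; rewrite eq_le measure_ge0 andbT.
apply/lee_addgt0Pr => eta eta0; rewrite add0e.
(* At most [M + 3] intervals of length [2 * hpow R n] will be used, of total length at most
   [8 * hpow R k]. *)
have [k hk] := hpow_lt R (eta / 8) (divr_gt0 eta0 (ltr0n _ 8)).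
have [n kn] := defect k.
have [N [S [Nle cov diam]]] := slab_cover R J n 0 1 (lexx _) ler01.
have ex j : exists a : R, S j `<=` `[a - hpow R n, a + hpow R n]%classic.
  have [[a Sa]|no] := pselect (S j !=set0); last first.
    by exists 0 => x Sx; exfalso; apply: no; exists x.
  exists a => x Sx; have := diam _ _ _ Sx Sa.
  by rewrite /= in_itv/= ler_norml => /andP[? ?]; apply/andP; split; lra.
have [a ha] := choice ex.
pose F j := `[a j - hpow R n, a j + hpow R n]%classic : set R.
apply: (@le_trans _ _ (\sum_(j < N) lebesgue_measure (F j))%E).
  apply: (@content_subadditive _ _ _ (@lebesgue_measure R) (cant R J 1) F N).
  - by move=> j _; exact: measurable_itv.
  - exact: (cant_measurable R J 1 unb).
  - move=> _ [b /= _ <-]; have [j jN Sj] := cov b (stair_itv R J b).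
    by rewrite -bigcup_mkord; exists j => //; exact: ha.
rewrite (eq_bigr (fun=> (2 * hpow R n)%:E)); last first.
  by move=> j _; rewrite lebesgue_centered// ltW// hpow_gt0.
rewrite sumEFin sumr_const card_ord lee_fin -mulr_natl.
have h0 := hpow_gt0 R n; have hnk : hpow R n <= hpow R k by apply: hpow_le; lia.
have := pow2_rank R J n k kn; move: Nle; rewrite subr0 mulr1.
set M : R := (2 ^ rank J n)%:R => NM MK; nra.
Qed.

(** * Separating annuli *)

Lemma curve_component (R : realType) (A : set (R * R)) (g : R -> R * R)
    (I : set R) (s t : R) :
  connected I -> continuous g -> g @` I `<=` A -> I s -> I t ->
  connected_component A (g s) (g t).
Proof.
move=> cI cg gA Is It.
apply: (connected_component_max (B := g @` I)) ; [by exists s|done| |by exists t].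
by apply: connected_continuous_connected => //; exact: continuous_subspaceT.
Qed.

Lemma continuous_pair (R : realType) (f g : R -> R) :
  continuous f -> continuous g -> continuous (fun t => (f t, g t) : R * R).
Proof. by move=> cf cg t; exact: (cvg_pair (cf t) (cg t)). Qed.

Lemma cdist_shift (R : realType) (w : R * R) (a b : R) :
  cdist (w.1 + a, w.2 + b) w = Num.sqrt (a ^+ 2 + b ^+ 2).
Proof. by rewrite /cdist /= [w.1 + a]addrC [w.2 + b]addrC !addrK. Qed.

Lemma connected_line (R : realType) : connected [set: R].
Proof. by apply/connected_intervalP => x y _ _ z _. Qed.

(** The segment from [w] to [z] stays within distance [r1] of [w]. *)
Lemma inner_component (R : realType) (w z : R * R) (r1 r2 : R) :
  cdist z w <= r1 -> connected_component (~` annulus w r1 r2) z w.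
Proof.
move=> zr; pose g (t : R) : R * R := (w.1 + t * (z.1 - w.1), w.2 + t * (z.2 - w.2)).
have <- : g 1 = z by rewrite /g !mul1r !subrKC; case: (z).
have {2}<- : g 0 = w by rewrite /g !mul0r !addr0; case: (w).
apply: (@curve_component _ _ _ `[0, 1]%classic).
- exact: segment_connected.
- apply: continuous_pair => t; apply: cvgD; try exact: cvg_cst;
    by apply: cvgM; [exact: cvg_id|exact: cvg_cst].
- move=> _ [t /= + <-] []; rewrite in_itv/= => /andP[t0 t1].
  rewrite cdist_shift !exprMn -mulrDr sqrtrM ?sqr_ge0// sqrtr_sqr ger0_norm//.
  move=> + _; rewrite ltNge => /negP; apply; apply: le_trans zr.
  by rewrite -[leRHS]mul1r ler_wpM2r// sqrtr_ge0.
- by rewrite /= in_itv/= ler01 lexx.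
- by rewrite /= in_itv/= ler01 lexx.
Qed.

(* Rotate about [w] to the ray issued from [w] in the direction of the first
   axis, then move along it. *)
Lemma outer_component (R : realType) (w z : R * R) (r1 r2 : R) : 0 < r2 ->
  r2 <= cdist z w ->
  connected_component (~` annulus w r1 r2) z (w.1 + r2, w.2).
Proof.
move=> r20 rz; pose v : R * R := (z.1 - w.1, z.2 - w.2).
pose g (t : R) : R * R := (w.1 + (v.1 * cos t - v.2 * sin t), w.2 + (v.1 * sin t + v.2 * cos t)).
have gw t : cdist (g t) w = cdist z w.
  rewrite cdist_shift /cdist -/(v.1) -/(v.2); congr Num.sqrt.
  have -> : (v.1 * cos t - v.2 * sin t) ^+ 2 + (v.1 * sin t + v.2 * cos t) ^+ 2 =
    (v.1 ^+ 2 + v.2 ^+ 2) * (cos t ^+ 2 + sin t ^+ 2) by ring.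
  by rewrite cos2Dsin2 mulr1.
have g0 : g 0 = z by rewrite /g cos0 sin0 !mulr0 !mulr1 subr0 add0r !subrKC; case: (z).
have cg : continuous g.
  apply: continuous_pair => t; apply: cvgD; try exact: cvg_cst.
    apply: cvgB; apply: cvgM; try exact: cvg_cst; [exact: continuous_cos|exact: continuous_sin].
  apply: cvgD; apply: cvgM; try exact: cvg_cst; [exact: continuous_sin|exact: continuous_cos].
have gA : g @` setT `<=` ~` annulus w r1 r2.
  by move=> _ [t _ <-] [_]; rewrite gw ltNge rz.
(* The second coordinate relative to [w] takes opposite values at angles 0 and pi. *)
have [t _ tE] : exists2 t, t \in `[0, pi] & v.1 * sin t + v.2 * cos t = 0.
  apply: IVT; first exact: pi_ge0.
    apply: continuous_subspaceT => t.
    apply: cvgD; apply: cvgM; try exact: cvg_cst; [exact: continuous_sin|exact: continuous_cos].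
  rewrite sin0 cos0 sinpi cospi !mulr0 !add0r mulr1 mulrN1 ge_min le_max.
  by case: (leP 0 v.2) => h; rewrite ?oppr_le0 ?oppr_ge0 ?h ?(ltW h) ?orbT.
(* If the first coordinate relative to [w] is negative, a further half turn makes it positive. *)
have [t' g2 g1] : exists2 t', (g t').2 = w.2 & w.1 <= (g t').1.
  have [h|h] := leP 0 (v.1 * cos t - v.2 * sin t).
    by exists t; rewrite /g /= ?tE ?addr0 ?lerDl.
  exists (t + pi); rewrite /g /= sinDpi cosDpi !mulrN.
    by rewrite -opprD tE oppr0 addr0.
  by move: h; rewrite lerDl /v /=; lra.
apply: connected_component_trans (_ : connected_component _ z (g t')) _.
  by rewrite -g0; apply: (curve_component _ _ _ setT) => //; exact: connected_line.
pose rho := (g t').1 - w.1.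
have rho0 : 0 <= rho by rewrite subr_ge0.
pose f (x : R) : R * R := (w.1 + x, w.2 + 0).
have gf : g t' = f rho by rewrite /f /rho subrKC addr0 -g2; case: (g t').
have rr : r2 <= rho.
  by have := gw t'; rewrite gf cdist_shift expr0n /= addr0 sqrtr_sqr ger0_norm// => ->.
rewrite gf (_ : (w.1 + r2, w.2) = f r2); last by rewrite /f addr0.
apply: (curve_component _ _ _ `[r2, rho]%classic).
- exact: segment_connected.
- apply: continuous_pair => x; last exact: cvg_cst.
  by apply: cvgD; [exact: cvg_cst|exact: cvg_id].
- move=> _ [x /= + <-] []; rewrite in_itv/= => /andP[rx _] _.
  rewrite cdist_shift expr0n /= addr0 sqrtr_sqr ger0_norm ?(le_trans (ltW r20))//.
  by rewrite ltNge rx.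
- by rewrite /= in_itv/= rr lexx.
- by rewrite /= in_itv/= rr lexx.
Qed.

(** The two parts of the complement of the annulus are connected; [w] lies in the inner one and [b]
    in the outer one. *)
Lemma separates_gap (R : realType) (w b : R * R) (r1 r2 : R) (F : set (R * R)) :
  0 < r2 -> F w -> F b -> r2 <= cdist b w ->
  (forall y, F y -> cdist y w <= r1 \/ r2 <= cdist y w) ->
  separates w r1 r2 F.
Proof.
move=> r20 Fw Fb br gap; split.
  rewrite -subset0 => y [Fy [y1 y2]].
  by case: (gap y Fy); [rewrite leNgt y1|rewrite leNgt y2].
move=> z nz; have [zr|zr] := leP (cdist z w) r1.
  by exists w; split=> //; exact: inner_component.
exists b; split=> //; apply: connected_component_trans (outer_component _ _ _ _ _ r20 _) _.
  by rewrite leNgt; apply/negP => zr2; exact: nz.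
by apply: connected_component_sym; exact: outer_component.
Qed.

Lemma cdist_gt0 (R : realType) (z w : R * R) : z <> w -> 0 < cdist z w.
Proof.
move=> zw; rewrite lt_neqAle cdist_ge0 andbT eq_sym; apply/eqP => e; apply: zw.
have := cdist_ge1 R z w; have := cdist_ge2 R z w.
rewrite e !normr_le0 !subr_eq0 => /eqP e2 /eqP e1.
by case: z w e1 e2 {e} => [? ?] [? ?] /= -> ->.
Qed.

(** The set [E] of the theorem. *)
Definition spot (R : realType) : set (R * R) := cant R free 1 `*` cant R free 1.

(** By [pt_gap] on the block starting at [a = 8 ^ k], with [q = hpow R (a + k)], each coordinate
    difference is at most [q] or at least [2 ^ k q - q]; two small ones give a distance at most
    [2 q]. *)
Lemma spot_gap (R : realType) (M d : R) : 0 < d ->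
  exists r1 r2 : R, [/\ 0 < r1, r1 < r2, r1 < d, M <= r2 / r1 &
    forall x y, spot R x -> spot R y -> cdist y x <= r1 \/ r2 <= cdist y x].
Proof.
move=> d0; have [n hn] := hpow_lt R (d / 2) (divr_gt0 d0 (ltr0n _ 2)).
(* [k >= n] brings [r1] below [d], [k >= 2] gives [r1 < r2], and [k >= 2 M] gives the ratio. *)
pose k := maxn (maxn n 2) (Num.truncn (2 * M)).+1; pose a := (8 ^ k)%N.
have h0 := hpow_gt0 R (a + k).
have hak : hpow R (a + k) <= hpow R n.
  by apply: hpow_le; rewrite (leq_trans _ (leq_addl _ _))// /k !leq_max leqnn.
have ha : hpow R a = (2 ^ k)%:R * hpow R (a + k).
  by rewrite /hpow exprD mulrCA [_%:R * _]mulrC hpow_natV mulr1.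
have k2 : (k.+1)%:R <= (2 ^ k)%:R :> R by rewrite ler_nat ltn_expl.
have k3 : 3 <= k.+1%:R :> R by rewrite ler_nat ltnS /k !leq_max leqnn orbT.
have kM : 2 * M <= k%:R.
  by rewrite (le_trans (ltW (truncnS_gt _)))// ler_nat /k leq_max leqnn orbT.
move: ha; rewrite -natr1 in k2 k3; set P : R := (2 ^ k)%:R in k2 *; set q := hpow R (a + k) => ha.
have P4 : 4 <= P.
  by rewrite /P -[4]/(4%:R) ler_nat (@leq_exp2l 2 2)// /k !leq_max leqnn orbT.
exists (2 * q), (hpow R a - q); split.
- by rewrite mulr_gt0.
- have : 4 * q <= P * q by rewrite ler_pM2r.
  by rewrite ha; have : 0 < q := h0; lra.
- by have : q <= hpow R n := hak; lra.
- have : (2 * M) * q <= (P - 1) * q by rewrite ler_pM2r//; lra.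
  by rewrite ler_pdivlMr ?mulr_gt0// ha; lra.
move=> x y [[b _ b1] [b' _ b2]] [[c _ c1] [c' _ c2]].
have flat l : (a <= l < a + k)%N -> free l = false by exact: free_block.
case: (pt_gap R free c b a k flat); last first.
  by rewrite b1 c1 => h; right; apply: le_trans h (cdist_ge1 _ _ _).
case: (pt_gap R free c' b' a k flat); last first.
  by rewrite b2 c2 => h _; right; apply: le_trans h (cdist_ge2 _ _ _).
rewrite b1 b2 c1 c2 -/q => h2 h1; left; apply: le_trans (cdist_le _ _ _) _; lra.
Qed.

(** A gap around a point [a] of [F], at a scale below the distance to another point [b], separates
    [F], with modulus at least [C + 1]. *)
Lemma spot_HNUP (R : realType) (K : set (R * R)) :
  compact K -> K `<=` spot R -> HNUP K.
Proof.
move=> cK KE; split=> // F FK [_ [a [b [Fa Fb ab]]] [C hC]].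
have ba0 : 0 < cdist b a by apply: cdist_gt0 => /esym.
have [r1 [r2 [r10 r12 r1d rM gap]]] := spot_gap R (expR (C + 1)) _ ba0.
have r20 : 0 < r2 by exact: lt_trans r12.
have FE y : F y -> spot R y by move=> /FK/KE.
have ra : r2 <= cdist b a.
  by case: (gap a b (FE _ Fa) (FE _ Fb)) => //; rewrite leNgt r1d.
have sep : separates a r1 r2 F.
  by apply: (separates_gap _ _ b) => // y Fy; apply: gap; exact: FE.
have := hC a r1 r2 r10 r12 sep; apply/negP; rewrite -ltNge.
apply: (@lt_le_trans _ _ (C + 1)); first by rewrite ltrDl.
by rewrite -[leLHS]expRK ler_ln ?posrE ?expR_gt0 ?divr_gt0.
Qed.

(** Place 0 is free, so some point is at least 1/2, while the zero string gives one at most 1/4; one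
    of the two is far from any given point. *)
Lemma pt_far (R : realType) (b : nat -> bool) :
  exists b', 1 / 8 <= `|pt R free b' - pt R free b|.
Proof.
pose b1 i := i == 0%N.
have p1 : 2^-1 <= pt R free b1.
  apply: le_trans (psum_le_stair R _ _ 1).
  by rewrite psumS psum0 wgt_predT /hpow expr1 /restr /free trunc_log0 /= mulr1n add0r.
have p0 : pt R free xpred0 <= 4^-1.
  apply: le_trans (stair_le_psum R _ _ 2) _.
  rewrite !psumS psum0 /restr !andbF !mulr0n !add0r rank_predT /hpow exprVn.
  by rewrite -natrX.
have [h|h] := leP (3 / 8) (pt R free b).
  by exists xpred0; rewrite distrC (le_trans _ (ler_norm _))//; lra.
by exists b1; rewrite (le_trans _ (ler_norm _))//; lra.
Qed.

(** * Logarithmic capacity *)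

(** Induction, with [(1 + 1/n)^n <= e]. *)
Lemma pow_le_fact_exp (R : realType) (n : nat) :
  (n%:R : R) ^+ n <= n`!%:R * expR n%:R.
Proof.
elim: n => [|n IH]; first by rewrite fact0 expR0 mulr1 expr0.
rewrite factS natrM exprS -mulrA ler_wpM2l//.
apply: (@le_trans _ _ (n%:R ^+ n * expR 1)); last first.
  by rewrite -natr1 expRD mulrA ler_wpM2r// expR_ge0.
case: n {IH} => [|n]; first by rewrite !expr0 mul1r (le_trans _ (expR_ge1Dx 1))// lerDl.
have n0 : 0 < n.+1%:R :> R by [].
have -> : n.+2%:R = n.+1%:R * (1 + n.+1%:R^-1) :> R.
  by rewrite mulrDr mulr1 divff ?gt_eqF// natr1.
rewrite exprMn ler_wpM2l ?exprn_ge0//.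
apply: (@le_trans _ _ (expR n.+1%:R^-1 ^+ n.+1)).
  by apply: lerXn2r; rewrite ?nnegrE ?expR_ge0 ?addr_ge0 ?invr_ge0 ?expR_ge1Dx.
by rewrite -expRM_natl -[_ *+ _]mulr_natl mulfV ?gt_eqF.
Qed.

(** For near points, [pt_holder] with exponent 1/2 and constant 4 is squared, giving 1/16; for
    distant ones the staircase difference is at most 1. *)
Lemma pt_quadratic (R : realType) : exists beta : R, [/\ 0 < beta, beta <= 1 &
  forall b b', beta * (stair R free b - stair R free b') ^+ 2 <=
    `|pt R free b - pt R free b'|].
Proof.
have half0 : 0 < 2^-1 :> R by [].
have half1 : 2^-1 < 1 :> R by rewrite invf_lt1// ltr1n.
have [n0 hn0] := rank_free_linear R 2^-1 0 half1.
have hk n : (n0 <= n)%N -> hpow R (rank free n) <= 1 * hpow R n `^ 2^-1.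
  move=> /hn0; rewrite addr0 => le_n; rewrite mul1r !hpow_powR -powRrM.
  by rewrite ler_powR ?ler1n// mulNr lerN2 mulrC.
pose beta : R := Num.min 16^-1 (hpow R n0).
have beta0 : 0 < beta by rewrite lt_min hpow_gt0 invr_gt0 ltr0n.
exists beta; split => //.
- by rewrite ge_min hpow_le1 orbT.
move=> b b'; set d := `|pt R free b - pt R free b'|.
have [lt_d|le_d] := ltP d (hpow R n0).
  have := pt_holder R free 2^-1 1 n0 half0 (ltW half1) ler01 hk b b' lt_d.
  rewrite -/d mulr1 => h; apply: (@le_trans _ _ (16^-1 * (4 * d `^ 2^-1) ^+ 2)).
    apply: ler_pM; rewrite ?sqr_ge0 ?(ltW beta0)//; first by rewrite ge_min lexx.
    by rewrite -real_normK ?num_real// lerXn2r ?nnegrE ?mulr_ge0 ?powR_ge0.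
  rewrite exprMn -[(d `^ _) ^+ 2]powR_mulrn ?powR_ge0// -powRrM mulVf// powRr1 ?normr_ge0//.
  by rewrite mulrA -natrX mulVf// mul1r.
apply: le_trans le_d; rewrite -[leRHS]mulr1 ler_pM ?sqr_ge0 ?(ltW beta0)//.
  by rewrite ge_min lexx orbT.
have := stair_itv R free b; have := stair_itv R free b' => /andP[? ?] /andP[? ?].
by rewrite -real_normK ?num_real// expr_le1// ler_norml; apply/andP; split; lra.
Qed.

Definition vandermonde_dist (R : realType) (n : nat) (z : 'I_n -> R * R) : R :=
  \prod_(j < n) \prod_(k < n | (j < k)%N) cdist (z j) (z k).

Lemma vandermonde_dist_ge0 (R : realType) n (z : 'I_n -> R * R) :
  0 <= vandermonde_dist R n z.
Proof. by do 2!apply: prodr_ge0 => ? _; exact: cdist_ge0. Qed.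

Lemma prod_lift (R : realType) n (i : 'I_n.+1) (F : 'I_n.+1 -> R) :
  \prod_(j < n) F (lift i j) = \prod_(j < n.+1 | j != i) F j.
Proof.
rewrite [RHS]big_mkcond (bigD1_ord i)//= eqxx mul1r.
by apply: eq_bigr => j _; rewrite eq_sym neq_lift.
Qed.

(* Each pair survives the deletion of a point [n - 1] times. *)
Lemma vandermonde_dist_lift (R : realType) n (z : 'I_n.+1 -> R * R) :
  \prod_(i < n.+1) vandermonde_dist R n (z \o lift i) = vandermonde_dist R n.+1 z ^+ n.-1.
Proof.
pose F (j k : 'I_n.+1) := if (j < k)%N then cdist (z j) (z k) else 1.
have -> : vandermonde_dist R n.+1 z = \prod_j \prod_k F j k.
  by apply: eq_bigr => j _; rewrite big_mkcond.
(* Deleting [i] keeps exactly the factors whose two indices differ from [i]. *)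
have e i : vandermonde_dist R n (z \o lift i) =
    \prod_(j < n.+1) \prod_(k < n.+1) (if (i != j) && (i != k) then F j k else 1).
  transitivity (\prod_(j < n.+1 | j != i) \prod_(k < n.+1 | k != i) F j k).
    rewrite -prod_lift; apply: eq_bigr => j _; rewrite -prod_lift big_mkcond.
    apply: eq_bigr => k _; rewrite /F /= /bump.
    by congr (if _ then _ else _); do 2!case: leqP => /=; lia.
  rewrite big_mkcond; apply: eq_bigr => j _; rewrite eq_sym.
  case: ifP => _; last by rewrite big1.
  by rewrite big_mkcond; apply: eq_bigr => k _; rewrite eq_sym.
rewrite (eq_bigr _ (fun i _ => e i)) exchange_big /= -prodrXl.
apply: eq_bigr => j _; rewrite exchange_big /= -prodrXl.
apply: eq_bigr => k _; rewrite -big_mkcond prodr_const.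
have [->|jk] := eqVneq j k; first by rewrite /F ltnn !expr1n.
congr (_ ^+ _); rewrite (eq_card (B := [predC pred2 j k])); last first.
  by move=> i; rewrite !inE negb_or.
by have /eqP := cardC (pred2 j k); rewrite card2 jk card_ord addSn eqSS => /eqP/(congr1 predn).
Qed.

(** [sup] has a default value on unbounded sets, hence the bound [L]. *)
Lemma cap_prod_ub (R : realType) (E : set (R * R)) (L : R) n (z : 'I_n -> R * R) :
  (forall x y, E x -> E y -> cdist x y <= L) -> (forall i, E (z i)) ->
  vandermonde_dist R n z <= cap_prod E n.
Proof.
move=> EL Ez; apply: ub_le_sup; last by exists z.
exists (\prod_(j < n) \prod_(k < n | (j < k)%N) L) => _ [y /= Ey <-].
apply: ler_prod => j _; rewrite prodr_ge0 /= => [|k _]; last exact: cdist_ge0.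
by apply: ler_prod => k _; rewrite cdist_ge0/= EL.
Qed.

(** Fekete's argument: [vandermonde_dist_lift] gives [P_(m+1) ^ (m-1) <= P_m ^ (m+1)], and roots are
    taken. *)
Lemma transfinite_diam_decr (R : realType) (E : set (R * R)) (L : R) n :
  (forall x y, E x -> E y -> cdist x y <= L) -> E !=set0 ->
  transfinite_diam E n.+3 <= transfinite_diam E n.+2.
Proof.
move=> EL [x0 Ex0]; rewrite /transfinite_diam /=.
set m := n.+2.
have P0 k : 0 <= cap_prod E k.
  by apply: le_trans (cap_prod_ub R E L k (fun=> x0) EL _) => //; exact: vandermonde_dist_ge0.
have m1 : 0 < m.-1%:R :> R by rewrite ltr0n.
have le_root : cap_prod E m.+1 <= (cap_prod E m ^+ m.+1) `^ m.-1%:R^-1.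
  apply: ge_sup; first by exists (vandermonde_dist R m.+1 (fun=> x0)), (fun=> x0).
  move=> _ [z /= Ez <-]; rewrite -/(vandermonde_dist R m.+1 z).
  have v0 := vandermonde_dist_ge0 R _ z.
  have -> : vandermonde_dist R m.+1 z = (vandermonde_dist R m.+1 z ^+ m.-1) `^ m.-1%:R^-1.
    by rewrite -powR_mulrn// -powRrM mulfV ?gt_eqF// powRr1.
  apply: ge0_ler_powR; rewrite ?nnegrE ?exprn_ge0 ?invr_ge0 ?(ltW m1)//.
  rewrite -vandermonde_dist_lift -[in leRHS](card_ord m.+1) -prodr_const.
  apply: ler_prod => i _; rewrite vandermonde_dist_ge0/=.
  by apply: (cap_prod_ub _ _ L) => // j; exact: Ez.
apply: (@le_trans _ _ (((cap_prod E m ^+ m.+1) `^ m.-1%:R^-1) `^ (2 / (m.+1 * m)%:R))).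
  by apply: ge0_ler_powR; rewrite ?nnegrE ?powR_ge0 ?divr_ge0.
rewrite -powR_mulrn// -!powRrM le_eqVlt; apply/orP; left; apply/eqP; congr powR.
have : m%:R != 0 :> R by rewrite pnatr_eq0.
have : m.+1%:R != 0 :> R by rewrite pnatr_eq0.
have : m.-1%:R != 0 :> R by rewrite pnatr_eq0.
rewrite !natrM; move: (m%:R) (m.+1%:R) (m.-1%:R) => u v w w0 v0 u0.
by field; rewrite u0 v0 w0.
Qed.

(** Row [j] contains the factors with [1 <= d < n - j]; the others are at most 1. *)
Lemma prod_distance_ge (R : realType) (x : nat -> R) n (j : 'I_n) :
  (forall d, (d <= n)%N -> 0 <= x d <= 1) ->
  \prod_(1 <= d < n.+1) x d <= \prod_(k < n | (j < k)%N) x (k - j)%N.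
Proof.
move=> x01.
have -> : \prod_(k < n | (j < k)%N) x (k - j)%N = \prod_(1 <= d < n - j) x d.
  rewrite -(big_mkord (fun k => (j < k)%N) (fun k => x (k - j)%N)).
  rewrite big_mkcond (@big_cat_nat _ _ _ j.+1)//=.
  rewrite [X in X * _]big_nat big1 ?mul1r => [|k]; last by move=> /andP[_]; rewrite ltnS leqNgt => /negbTE ->.
  rewrite -{1}[j.+1]add1n big_addn; apply: eq_big_nat => k /andP[k1 _].
  by rewrite -{1}[(j : nat)]add0n ltn_add2r k1 addnK.
rewrite (@big_cat_nat _ _ _ (n - j))//=; [|by rewrite subn_gt0|by rewrite leqW ?leq_subr].
rewrite -[leRHS]mulr1 ler_wpM2l//.
  by rewrite big_nat prodr_ge0// => d /andP[_ dn]; have /andP[] := x01 d (leq_trans (ltnW dn) (leq_subr _ _)).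
rewrite big_nat; apply: Num.Theory.prodr_ile1 => d /andP[_ dn].
by have := x01 d; rewrite -ltnS => /(_ dn).
Qed.

(** The product of the [d / m] is [m! / m^m >= e^-m]. *)
Lemma row_bound (R : realType) (beta : R) m : 0 < beta ->
  (beta * expR (- 2)) ^+ m <= \prod_(1 <= d < m.+1) (beta * (d%:R / m%:R) ^+ 2).
Proof.
move=> b0; rewrite big_split/= prodr_const_nat subn1/= exprMn ler_pM2l ?exprn_gt0//.
rewrite prodrXl big_split/= prodr_const_nat subn1/= -natr_prod -fact_prod.
have -> : expR (- 2) ^+ m = expR (- m%:R) ^+ 2 :> R.
  by rewrite -!expRM_natl !mulrN mulrC.
apply: lerXn2r; rewrite ?nnegrE ?expR_ge0 ?mulr_ge0 ?exprn_ge0 ?invr_ge0//.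
have [->|m0] := posnP m; first by rewrite oppr0 expR0 expr0 mulr1 fact0.
have mm0 : 0 < m%:R ^+ m :> R by rewrite exprn_gt0// ltr0n.
rewrite exprVn expRN -[leLHS]mul1r ler_pdivrMr ?expR_gt0// mulrAC.
by rewrite ler_pdivlMr// mul1r pow_le_fact_exp.
Qed.

(** Points with staircase values [j / m] and a common second coordinate have mutual distances at
    least [beta * ((k - j) / m) ^ 2]. Each of the [m] rows of the product is then at least
    [gam ^ m]. *)
Lemma spot_cap_gt0 (R : realType) : 0 < log_capacity (spot R).
Proof.
have [beta [b0 b1 quad]] := pt_quadratic R.
have unb : forall k, exists n, (k <= rank free n)%N.
  apply: (rank_unbounded R free 2^-1 0) => //.
  by apply: rank_free_linear; rewrite invf_lt1// ltr1n.
have EL x y : spot R x -> spot R y -> cdist x y <= 2.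
  move=> [[b _ xb] [b' _ xb']] [[c _ yc] [c' _ yc']].
  apply: le_trans (cdist_le _ _ _) _; rewrite -xb -xb' -yc -yc' /pt.
  have := stair_itv R xpredT (restr free b); have := stair_itv R xpredT (restr free c).
  have := stair_itv R xpredT (restr free b'); have := stair_itv R xpredT (restr free c').
  move=> /andP[? ?] /andP[? ?] /andP[? ?] /andP[? ?].
  by rewrite [2](_ : _ = 1 + 1)// lerD// ler_norml; apply/andP; split; lra.
have E_pt b c : spot R (pt R free b, pt R free c).
  by split=> /=; [exists b|exists c] => //=; [have /andP[] := stair_itv R free b|have /andP[] := stair_itv R free c].
pose gam : R := beta * expR (- 2).
have g0 : 0 < gam by rewrite mulr_gt0 ?expR_gt0.
have g1 : gam <= 1.
  by rewrite -[leRHS]mulr1 ler_pM ?expR_ge0 ?(ltW b0)// -[leRHS]expR0 ler_expR; lra.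
have low n : gam ^+ 4 <= transfinite_diam (spot R) n.+2.
  set m := n.+2; have m0 : 0 < m%:R :> R by [].
  have ex (j : 'I_m) : exists b, stair R free b = j%:R / m%:R.
    apply: stair_surj => //; rewrite divr_ge0//= ler_pdivrMr// mul1r ler_nat.
    exact: ltnW.
  have [b hb] := choice ex.
  pose x (d : nat) : R := beta * (d%:R / m%:R) ^+ 2.
  have x01 d : (d <= m)%N -> 0 <= x d <= 1.
    move=> dm; rewrite mulr_ge0 ?(ltW b0) ?sqr_ge0//= -[leRHS]mulr1.
    rewrite ler_pM ?sqr_ge0 ?(ltW b0)// expr_le1 ?divr_ge0//.
    by rewrite ler_pdivrMr// mul1r ler_nat.
  have row : gam ^+ m <= \prod_(1 <= d < m.+1) x d by exact: row_bound.
  pose z (j : 'I_m) := (pt R free (b j), pt R free xpred0).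
  have V : gam ^+ (m * m) <= vandermonde_dist R m z.
    have -> : gam ^+ (m * m) = \prod_(j < m) gam ^+ m by rewrite prodr_const card_ord exprM.
    apply: ler_prod => j _; rewrite exprn_ge0 ?(ltW g0)// andTb.
    apply: le_trans row _; apply: le_trans (prod_distance_ge R x m j x01) _.
    apply: ler_prod => k jk; have /andP[-> _]/= : 0 <= x (k - j)%N <= 1.
      by apply: x01; rewrite (leq_trans (leq_subr _ _))// ltnW.
    apply: le_trans (cdist_ge1 _ _ _) => /=; apply: le_trans (quad _ _).
    rewrite !hb /x -mulrBl -[_ - _]opprB mulNr sqrrN natrB//; exact: ltnW.
  have P : gam ^+ (m * m) <= cap_prod (spot R) m.
    apply: le_trans V _; apply: (cap_prod_ub _ _ 2) => // j; exact: E_pt.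
  rewrite /transfinite_diam.
  (* The exponent is [2 m / (m - 1) <= 4] as [m >= 2], and [gam <= 1]. *)
  apply: (@le_trans _ _ ((gam ^+ (m * m)) `^ (2 / (m * m.-1)%:R))); last first.
    by apply: ge0_ler_powR; rewrite ?nnegrE ?divr_ge0 ?exprn_ge0 ?(ltW g0)// (le_trans _ P)// exprn_ge0// ltW.
  rewrite -!powR_mulrn ?(ltW g0)// -powRrM; apply: ger_powR; first by rewrite g0.
  by rewrite mulrA ler_pdivrMr ?ltr0n// -!natrM ler_nat /m /=; lia.
(* Monotonicity is available from index 2 on, hence the shift. *)
have cv : cvgn (transfinite_diam (spot R)).
  apply/cvg_ex.
  have : cvgn [sequence transfinite_diam (spot R) (n + 2)%N]_n.
    apply: nonincreasing_is_cvgn.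
      apply/nonincreasing_seqP => n; rewrite /= !addn2.
      by apply: (transfinite_diam_decr R _ 2) => //; exists (pt R free xpred0, pt R free xpred0).
    by exists (gam ^+ 4) => _ [n _ <-] /=; rewrite addn2.
  by move/cvg_ex => [l]; rewrite cvg_shiftn => h; exists l.
apply: (@lt_le_trans _ _ (gam ^+ 4)); first by rewrite exprn_gt0.
apply: limr_ge => //; exists 2%N => // -[|[|n]] //= _; exact: low.
Qed.

(** * The theorem *)

Lemma spot_subset (R : realType) (s c : R) : 0 < s -> s < 2 -> 0 < c ->
  exists K : set (R * R),
    [/\ K `<=` spot R, compact K & hausdorff_measure s K = c%:E].
Proof.
move=> s0 s2 c0; rewrite -[s](@divfK _ 2)// mulrC.
have s1 : s / 2 < 1 by rewrite ltr_pdivrMr// mul1r.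
apply: exists_subset; rewrite ?divr_gt0 ?(ltW s1)// => C.
exact: rank_free_linear.
Qed.

(** If [H^t] vanished for some [t < 2], so would [H^s] at the midpoint [s] of [t] and 2, against a
    subset with [H^s] equal to 1. *)
Lemma spot_dim (R : realType) : hausdorff_dim (spot R) = 2%:E.
Proof.
have H2 : hausdorff_measure 2 (spot R) = 0%E.
  by apply: cant_hm2 => k; exists (8 ^ k + k)%N; rewrite leq_add2r rank_free_block.
apply: hausdorff_dim_eq => // [t t2|t t0 t2 Ht].
  by apply: (hm_dim_gt R 2) => //; rewrite H2 ltry.
pose s := (t + 2) / 2.
have [ts s2] : t < s /\ s < 2 by rewrite /s; split; lra.
have [K [KE _ HK]] := spot_subset R s 1 (le_lt_trans t0 ts) s2 ltr01.
have := hm_mono R s _ _ KE; rewrite HK (hm_dim_gt R t s) ?Ht ?ltry//.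
by rewrite lee_fin ler10.
Qed.

Theorem theorem1p3 (R : realType) :
  exists E : set (R * R),
    [/\ HNUP E,
        hausdorff_dim E = 2%:E,
        m2 E = 0%E &
        0 < log_capacity E] /\
    (forall s c : R, 0 < s -> s < 2 -> 0 < c ->
       exists K : set (R * R),
         [/\ K `<=` E,
             HNUP K,
             hausdorff_dim K = s%:E &
             hausdorff_measure s K = c%:E]) /\
    (forall (x : R * R) (M : R), E x -> 1 < M ->
       exists r1 r2 : R,
         [/\ 0 < r1,
             0 < r2,
             M <= r2 / r1,
             [set y | r1 < cdist y x /\ cdist y x < r2] `<=` ~` E &
             [set y | r2 <= cdist y x] `&` E !=set0]).
Proof.
have unb : forall k, exists n, (k <= rank free n)%N.
  apply: (rank_unbounded R free 2^-1 0) => //.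
  by apply: rank_free_linear; rewrite invf_lt1// ltr1n.
exists (spot R); split; [split|split].
- by apply: spot_HNUP => //; apply: compact_setX; exact: cant_compact.
- exact: spot_dim.
- rewrite m2_setX; [|exact: cant_measurable|exact: cant_measurable].
  rewrite cant_null ?mul0e// => k.
  by exists (8 ^ k + k)%N; rewrite leq_add2r rank_free_block.
- exact: spot_cap_gt0.
- move=> s c s0 s2 c0; have [K [KE cK HK]] := spot_subset R s c s0 s2 c0.
  exists K; split=> //; first exact: spot_HNUP.
  (* A positive finite [H^s] determines the dimension. *)
  apply: hausdorff_dim_eq; first exact: ltW.
    by move=> t st; apply: (hm_dim_gt R s) => //; rewrite ?ltW ?HK ?ltry.
  move=> t t0 ts Ht; have := hm_dim_gt R t s K t0 ts.
  by rewrite Ht HK ltry => /(_ isT) [] /eqP; rewrite gt_eqF.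
- move=> x M Ex _.
  have [r1 [r2 [r10 r12 r1d rM gap]]] := spot_gap R M (1 / 8) (divr_gt0 ltr01 (ltr0n _ 8)).
  exists r1, r2; split=> //; first exact: lt_trans r12.
    move=> y [y1 y2] Ey; case: (gap x y Ex Ey); [rewrite leNgt y1|rewrite leNgt y2]; done.
  (* Moving the first coordinate by at least [1 / 8 > r1] gives a point of [E] beyond the gap. *)
  move: (Ex) => [[b _ xb] Ex2]; have [b' far] := pt_far R b.
  have Ey : spot R (pt R free b', x.2).
    by split=> //=; exists b' => //=; have /andP[] := stair_itv R free b'.
  exists (pt R free b', x.2); split=> //=.
  case: (gap x _ Ex Ey) => //; rewrite leNgt => /negP[].
  apply: lt_le_trans r1d _; apply: le_trans (cdist_ge1 _ _ _) => /=.
  by rewrite -xb.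
Qed.
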